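(* Let $N\ge 3$, $p>2^*-1=\frac{N+2}{N-2}$, and let $u$ be a radial solution of $$\nabla\cdot\left[\frac{\nabla u}{\sqrt{1-|\nabla u|^2}}\right]+u^p=0\ \text{ in }\mathbb{R}^N,\qquad u(x)>0\ \text{ in }\mathbb{R}^N,\qquad u(x)\to 0\ \text{ as }|x|\to\infty.$$ Then one of the following possibilities holds: 1. $u\in\mathcal{D}^{1,2}(\mathbb{R}^N)$ and $u(x)=O\big(1/|x|^{N-2}\big)$ as $|x|\to+\infty$; 2. $u\notin\mathcal{D}^{1,2}(\mathbb{R}^N)$ and there exist $c_1,c_2>0$ such that $$\frac{c_1}{|x|^{\frac{2N}{(N-1)(p+1)-2N}}}\le u(x)\le \frac{c_2}{|x|^{\frac{2}{p-1}}}$$ for all $|x|$ sufficiently large; moreover, there exists no $\alpha>\frac{2}{p-1}$ for which there is some $c>0$ with $u(x)\le c/|x|^\alpha$ for all $|x|$ sufficiently large.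
   Context: Here $2^*=\frac{2N}{N-2}$, and $\mathcal{D}^{1,2}(\mathbb{R}^N)$ is the completion of $C_c^\infty(\mathbb{R}^N)$ with respect to the norm $\|\nabla u\|_{L^2(\mathbb{R}^N)}$. Solutions are understood in the classical sense, with $|\nabla u|<1$ everywhere. A radial function $u$ on $\mathbb{R}^N$ is identified with a function of $r=|x|$; radial solutions correspond to global positive functions $u(r)$, $r\ge 0$, vanishing at infinity, with $|u'|<1$, $u'(0)=0$ and $$\left(\frac{u'}{\sqrt{1-(u')^2}}\right)'+\frac{N-1}{r}\frac{u'}{\sqrt{1-(u')^2}}+u^p=0\quad\text{for } r>0.$$ *)

(* Defs.v *)
From HB Require Import structures.
From mathcomp Require Import all_boot all_order all_algebra.
From mathcomp Require Import all_classical all_reals all_analysis.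

Set Implicit Arguments.
Unset Strict Implicit.
Unset Printing Implicit Defensive.

Import Order.TTheory GRing.Theory Num.Theory.
Import numFieldNormedType.Exports.

Local Open Scope classical_set_scope.
Local Open Scope ring_scope.

(* The library norm on 'rV[R]_N is the sup norm; [enorm] is the Euclidean one
   (both induce the topology used for continuity and derivatives). *)
Definition enorm (R : realType) (N : nat) (x : 'rV[R]_N) : R :=
  Num.sqrt (\sum_(i < N) x ord0 i ^+ 2).

Definition at_infty (R : realType) (N : nat) : set_system 'rV[R]_N :=
  filter_from [set: R] (fun M => [set x | M < enorm x]).
Arguments at_infty {R N}.

Global Instance at_infty_filter (R : realType) (N : nat) :
  Filter (@at_infty R N).
Proof.
apply: filter_from_filter; first by exists 0.
move=> M1 M2 _ _; exists (Num.max M1 M2) => // x /=.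
by rewrite gt_max => /andP[].
Qed.

Canonical at_infty_filter_on (R : realType) (N : nat) :=
  FilterType (@at_infty R N) (@at_infty_filter R N).

Definition radial (R : realType) (N : nat) (u : 'rV[R]_N -> R) : Prop :=
  forall x y, enorm x = enorm y -> u x = u y.

Section Differential.
Context {R : realType} {N : nat}.
Implicit Types (u : 'rV[R]_N -> R) (F : 'rV[R]_N -> 'rV[R]_N).

Definition partial (i : 'I_N) u : 'rV[R]_N -> R :=
  'D_(delta_mx ord0 i : 'rV[R]_N) u.

Definition grad u (x : 'rV[R]_N) : 'rV[R]_N := \row_(i < N) partial i u x.

Definition divergence F (x : 'rV[R]_N) : R :=
  \sum_(i < N) partial i (fun y => F y ord0 i) x.

Fixpoint Ck (k : nat) u : Prop :=
  if k is k'.+1 then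
    continuous u /\
    forall i : 'I_N,
      (forall x, derivable u x (delta_mx ord0 i : 'rV[R]_N)) /\
      Ck k' (partial i u)
  else continuous u.

Definition smooth u : Prop := forall k, Ck k u.

Definition test_function u : Prop :=
  smooth u /\ compact (closure [set x | u x != 0]).

Definition mean_curvature u : 'rV[R]_N -> R :=
  divergence (fun x => (Num.sqrt (1 - enorm (grad u x) ^+ 2))^-1 *: grad u x).

End Differential.

(* Lebesgue measure on R^N.  Row vectors carry the sigma-algebra generated by
   the coordinates, as the library does for tuples. *)

Definition measure_rV_display : measure_display. Proof. exact. Qed.

Section measurable_rV.
Context {R : realType}.
Variable n : nat.

Let coors : 'I_n -> 'rV[R]_n -> measurableTypeR R := fun i x => x ord0 i.

Let rV_set0 : g_sigma_preimage coors set0.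
Proof. exact: sigma_algebra0. Qed.

Let rV_setC A : g_sigma_preimage coors A -> g_sigma_preimage coors (~` A).
Proof. exact: sigma_algebraC. Qed.

Let rV_bigcup (F : _^nat) : (forall i, g_sigma_preimage coors (F i)) ->
  g_sigma_preimage coors (\bigcup_i (F i)).
Proof. exact: sigma_algebra_bigcup. Qed.

HB.instance Definition _ := @isMeasurable.Build measure_rV_display
  'rV[R]_n (g_sigma_preimage coors) rV_set0 rV_setC rV_bigcup.

End measurable_rV.

Lemma measurable_coord (R : realType) (n : nat) (i : 'I_n) :
  measurable_fun [set: 'rV[R]_n]
    (fun x => x ord0 i : measurableTypeR R).
Proof.
move=> _ Y mY; rewrite setTI; apply: sub_sigma_algebra => /=.
rewrite -bigcup_seq/=; exists i => /=; first by rewrite mem_index_enum.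
by exists Y => //; rewrite setTI.
Qed.

Lemma measurable_fun_rVP d (T : measurableType d) (R : realType) (n : nat)
    (f : T -> 'rV[R]_n) :
  measurable_fun [set: T] f <->
  forall i, measurable_fun [set: T] (fun t => f t ord0 i : measurableTypeR R).
Proof.
split=> [mf i|mf].
  exact: (measurableT_comp (measurable_coord i) mf).
suff prefS : g_sigma_preimage
    (fun i => (fun x : 'rV[R]_n => x ord0 i : measurableTypeR R) \o f) `<=`
    measurable.
  move=> _ A mA; apply: prefS; rewrite g_sigma_preimage_comp.
  by exists A.
apply: smallest_sub; first exact: sigma_algebra_measurable.
case: n => [|n] in f mf *; first by rewrite big_ord0.
rewrite -bigcup_mkord_ord; apply: bigcup_sub => i Ii.
by move=> A [B mB <-]; exact: mf.
Qed.

Definition rV_cons (R : realType) (n : nat)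
    (p : measurableTypeR R * 'rV[R]_n) : 'rV[R]_n.+1 :=
  \row_(i < n.+1) oapp (fun j => p.2 ord0 j) p.1 (unlift ord0 i).

Lemma measurable_rV_cons (R : realType) (n : nat) :
  measurable_fun [set: measurableTypeR R * 'rV[R]_n] (@rV_cons R n).
Proof.
apply/measurable_fun_rVP => i.
case: (unliftP ord0 i) => [j ->|->].
  have := measurableT_comp (measurable_coord j)
    (@measurable_snd _ _ (measurableTypeR R) 'rV[R]_n).
  by congr measurable_fun; apply/funext => t; rewrite /= mxE liftK.
have := @measurable_fst _ _ (measurableTypeR R) 'rV[R]_n.
by congr measurable_fun; apply/funext => t; rewrite /= mxE unlift_none.
Qed.

HB.instance Definition _ (R : realType) (n : nat) :=
  isMeasurableFun.Build _ _ _ _ (@rV_cons R n) (@measurable_rV_cons R n).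

Section lebesgue_rV_succ.
Context {R : realType} {n : nat}.
Variable mu : {sigma_finite_measure set 'rV[R]_n -> \bar R}.
Local Open Scope ereal_scope.

Definition lebesgue_rV_succ : set 'rV[R]_n.+1 -> \bar R :=
  pushforward (lebesgue_measure \x mu) (@rV_cons R n).

Let lebesgue_rV_succ0 : lebesgue_rV_succ set0 = 0.
Proof. exact: measure0. Qed.

Let lebesgue_rV_succ_ge0 A : 0 <= lebesgue_rV_succ A.
Proof. exact: measure_ge0. Qed.

Let lebesgue_rV_succ_sigma_additive : semi_sigma_additive lebesgue_rV_succ.
Proof. exact: measure_semi_sigma_additive. Qed.

HB.instance Definition _ := isMeasure.Build _ _ _ lebesgue_rV_succ
  lebesgue_rV_succ0 lebesgue_rV_succ_ge0 lebesgue_rV_succ_sigma_additive.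

Let lebesgue_rV_succ_sigma_finite : sigma_finite setT lebesgue_rV_succ.
Proof.
have [F FT mF] : sigma_finite setT (lebesgue_measure \x mu).
  have /sigma_finiteP[G [TG ndG Goo]] := sigma_finiteT (@lebesgue_measure R).
  have /sigma_finiteP[H [TH ndH Hoo]] := sigma_finiteT mu.
  exists (fun k => G k `*` H k).
    rewrite -setXTT TG TH predeqE => -[x y]; split.
      move=> [/= [k _ Gkx] [l _ Hly]]; exists (maxn k l) => //; split.
      - by move: x Gkx; exact/subsetPset/ndG/leq_maxl.
      - by move: y Hly; exact/subsetPset/ndH/leq_maxr.
    by move=> [k _ []/= ? ?]; split; exists k.
  move=> k; have [? ?] := Goo k; have [? ?] := Hoo k.
  split; first exact: measurableX.
  by rewrite product_measure1E// lte_mul_pinfty// ge0_fin_numE.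
pose uncons (x : 'rV[R]_n.+1) : measurableTypeR R * 'rV[R]_n :=
  (x ord0 ord0, \row_(i < n) x ord0 (lift ord0 i)).
have unconsK : cancel (@rV_cons R n) uncons.
  move=> [a v]; rewrite /uncons !mxE unlift_none; congr pair.
  by apply/rowP => i; rewrite !mxE liftK.
have muncons : measurable_fun setT uncons.
  apply/measurable_fun_pairP; split; first exact: measurable_coord.
  apply/measurable_fun_rVP => i.
  have := @measurable_coord R _ (lift ord0 i : 'I_n.+1).
  by congr measurable_fun; apply/funext => t; rewrite /= mxE.
exists (fun k => uncons @^-1` F k).
  by rewrite -preimage_bigcup -FT preimage_setT.
move=> k; split.
  by rewrite -[X in measurable X]setTI; apply: muncons => //; have [] := mF k.
rewrite /lebesgue_rV_succ /pushforward -comp_preimage.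
rewrite (_ : uncons \o @rV_cons R n = id); first by have [] := mF k.
by apply/funext => p; exact: unconsK.
Qed.

HB.instance Definition _ := Measure_isSigmaFinite.Build _ _ _
  lebesgue_rV_succ lebesgue_rV_succ_sigma_finite.

End lebesgue_rV_succ.

Fixpoint lebesgue_rV (R : realType) (n : nat) :
    {sigma_finite_measure set 'rV[R]_n -> \bar R} :=
  if n is n'.+1 then lebesgue_rV_succ (lebesgue_rV R n')
  else dirac (0 : 'rV[R]_0).

Lemma lebesgue_rV_box (R : realType) (n : nat)
    (A : 'I_n -> set (measurableTypeR R)) :
  (forall i, measurable (A i)) ->
  lebesgue_rV R n [set x | forall i, A i (x ord0 i)] =
  (\prod_(i < n) lebesgue_measure (A i))%E.
Proof.
elim: n A => [|n IH] A mA.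
  rewrite big_ord0 /= diracE mem_set //; by case.
have mB m (B : 'I_m -> set (measurableTypeR R)) : (forall i, measurable (B i)) ->
    measurable [set x : 'rV[R]_m | forall i, B i (x ord0 i)].
  move=> mB; rewrite (_ : mkset _ =
    \big[setI/setT]_(i < m) ((fun x : 'rV[R]_m => x ord0 i) @^-1` B i)).
    apply: bigsetI_measurable => i _; rewrite -[X in measurable X]setTI.
    exact: (measurable_coord i).
  rewrite predeqE => x; split=> [Bx|].
    by rewrite -bigcap_seq => i _; exact: Bx.
  by rewrite -bigcap_seq => + i; apply; rewrite /= mem_index_enum.
rewrite big_ord_recl /= /lebesgue_rV_succ /pushforward.
rewrite -(IH (fun i => A (lift ord0 i))) //.
rewrite -product_measure1E //; last first.
  by apply: (mB _ (fun i => A (lift ord0 i))) => i.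
congr (product_measure1 _ _ _); rewrite predeqE => -[a v]; split => /=.
  move=> H; split; first by have := H ord0; rewrite mxE unlift_none.
  by move=> i; have := H (lift ord0 i); rewrite mxE liftK.
move=> [Ha Hv] i; case: (unliftP ord0 i) => [j ->|->]; rewrite mxE.
  by rewrite liftK; exact: Hv.
by rewrite unlift_none.
Qed.

Definition crit_exp (R : realType) (N : nat) : R := 2 * N%:R / (N%:R - 2).

Section D12.
Context {R : realType} {N : nat}.
Implicit Types u : 'rV[R]_N -> R.
Local Open Scope ereal_scope.

Definition gradL2 u : \bar R :=
  'N[lebesgue_rV R N]_2%:E[EFin \o (@enorm R N \o grad u)].

(* By the Sobolev inequality (N >= 3) every sequence of test functions that is
   Cauchy for [gradL2] converges in L^{2^*}, and its limit determines its class
   in the completion: D^{1,2} is the set of these limits. *)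
Definition D12 u : Prop :=
  exists phi : nat -> 'rV[R]_N -> R,
    [/\ forall n, test_function (phi n),
        forall e : R, (0 < e)%R ->
          \forall m & n \near \oo, gradL2 (phi m \- phi n)%R < e%:E &
        'N[lebesgue_rV R N]_(crit_exp R N)%:E[EFin \o (phi n \- u)%R]
          @[n --> \oo] --> 0].

End D12.

(* Main.v *)
(** Write u = U(r), w = -U' / sqrt (1 - U'^2), a0 = 2 / (p - 1).  Then
    (r^(N-1) w)' = r^(N-1) U^p, so U decreases, w >= r U^p / (2 N), and since the
    energy H = sqrt (1 + w^2) - 1 + U^(p+1) / (p+1) decreases, -U' >= k r U^p,
    which integrates to U <= C r^(-a0).

    If U <= C r^(-a) for some a > a0, integrating the equation repeatedly
    improves a geometrically away from a0 until U = O(r^(2-N)) and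
    w = O(r^(1-N)); then u lies in D^{1,2}, because U'(r) / r, as a function of
    r^2, is approximated in a weighted sup norm by derivatives of smooth
    functions of compact support.  Conversely, u in D^{1,2} and u decreasing give
    U <= C r^(-(N-2)/2), and (N-2)/2 > a0 as p is supercritical.  So D^{1,2} is
    equivalent to the existence of such an a.

    The Pohozaev functional P = r^N H - (N / (p+1)) r^(N-1) w U is eventually
    nonincreasing.  If it stays nonnegative, then -U' >= k r U^th with th < p,
    and again U <= C r^(-a) with a > a0.  If it becomes negative, then
    H U^(-2q) is nonincreasing for q = (N-1)(p+1) / (2N); hence -U' <= C U^q,
    which integrates to the lower bound with exponent
    1 / (q - 1) = 2N / ((N-1)(p+1) - 2N). *)
Require Import Defs.
From HB Require Import structures.
From mathcomp Require Import all_boot all_order all_algebra.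
From mathcomp Require Import all_classical all_reals all_analysis.
From mathcomp Require Import measurable_realfun.
From mathcomp Require Import ring lra.

Set Implicit Arguments.
Unset Strict Implicit.
Unset Printing Implicit Defensive.

Import Order.TTheory GRing.Theory Num.Theory.
Import numFieldNormedType.Exports.

Local Open Scope classical_set_scope.
Local Open Scope ring_scope.

(** Taking the pair (U, w) as unknown makes |U'| < 1 automatic, since -U' = w / sqrt (1 + w^2), and
    leaves a divergence that is linear in w; the nonlinearity of the operator survives only in the
    factor sqrt (1 + w^2), which the energy bounds and which tends to 1 with the decay of w. Along
    the ray no improper integral is formed: integrating a differential inequality means checking
    that an explicit auxiliary function is monotone, and the limit of U at infinity enters by
    contradiction. Membership in D^{1,2} rests on pointwise bounds by powers of 1 + r^2. These are
    dominated by products of one-variable weights, so integrals over R^n become iterated integrals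
    on the line, and a single weighted bound on derivatives controls both the L^2 norm of the
    gradient and the L^{2*} norm of the function. The variable r^2 is used because smooth functions
    of it remain smooth at the origin, where r itself is not differentiable. Existence of a rate a >
    a0 is also what the last clause of the second alternative denies, so one case distinction
    decides the theorem. *)

Section RealCalculus.
Context {R : realType}.
Implicit Types (f g df : R -> R) (x y a b : R).

Lemma powR_addp x a b : 0 < x -> x `^ (a + b) = x `^ a * x `^ b.
Proof. by move=> x0; rewrite powRD // (gt_eqF x0) implybT. Qed.

Lemma powR_subp x a b : 0 < x -> x `^ (a - b) = x `^ a / x `^ b.
Proof. by move=> x0; rewrite powR_addp // powRN. Qed.

Lemma powR_sub1 x a : 0 < x -> x `^ (a - 1) = x `^ a / x.
Proof. by move=> x0; rewrite powR_subp // powRr1 // ltW. Qed.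

Lemma powR_add1 x a : 0 < x -> x `^ (a + 1) = x `^ a * x.
Proof. by move=> x0; rewrite powR_addp // powRr1 // ltW. Qed.

Lemma powR_opp_le x y a : 0 <= a -> 0 < x -> x <= y -> y `^ (- a) <= x `^ (- a).
Proof.
move=> a0 x0 xy; rewrite !powRN lef_pV2 ?posrE ?powR_gt0 //; last exact: lt_le_trans xy.
by apply: ge0_ler_powR => //; rewrite nnegrE ltW // (lt_le_trans x0).
Qed.

Lemma powR_le x y a : 0 <= a -> 0 <= x -> x <= y -> x `^ a <= y `^ a.
Proof.
move=> a0 x0 xy; apply: ge0_ler_powR => //; rewrite nnegrE //.
exact: le_trans xy.
Qed.

Lemma powR_le_exp x a b : 1 <= x -> a <= b -> x `^ a <= x `^ b.
Proof. by move=> x1 ab; exact: ler_powR. Qed.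

Lemma bernoulli_ineq x (k : nat) : 0 <= x -> 1 + k%:R * x <= (1 + x) ^+ k.
Proof.
move=> x0; elim: k => [|k IH]; first by rewrite mul0r addr0.
rewrite exprS; apply: le_trans (_ : (1 + x) * (1 + k%:R * x) <= _).
  have : 0 <= k%:R * (x * x) by rewrite !mulr_ge0.
  by rewrite -natr1; set K := k%:R; lra.
by rewrite ler_wpM2l // addr_ge0.
Qed.

Lemma derD f g x a b : is_derive x 1 f a -> is_derive x 1 g b ->
  is_derive x 1 (fun y => f y + g y) (a + b).
Proof. by move=> Df Dg; exact: is_deriveD. Qed.

Lemma derN f x a : is_derive x 1 f a -> is_derive x 1 (fun y => - f y) (- a).
Proof. by move=> Df; exact: is_deriveN. Qed.

Lemma derB f g x a b : is_derive x 1 f a -> is_derive x 1 g b ->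
  is_derive x 1 (fun y => f y - g y) (a - b).
Proof. by move=> Df Dg; exact: is_deriveB. Qed.

Lemma derM f g x a b : is_derive x 1 f a -> is_derive x 1 g b ->
  is_derive x 1 (fun y => f y * g y) (a * g x + f x * b).
Proof.
move=> Df Dg; apply: (is_derive_eq (is_deriveM Df Dg)).
by rewrite /GRing.scale /= addrC [g x * a]mulrC.
Qed.

Lemma derZ f x c a : is_derive x 1 f a -> is_derive x 1 (fun y => c * f y) (c * a).
Proof. by move=> Df; exact: is_deriveZ. Qed.

Lemma dercst c x : is_derive x 1 (fun _ : R => c : R) (0 : R).
Proof. exact: is_derive_cst. Qed.

Lemma derid x : is_derive x 1 (fun y : R => y : R) (1 : R).
Proof. exact: is_derive_id. Qed.

Lemma der_comp f g x a b : is_derive (g x) 1 f a -> is_derive x 1 g b ->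
  is_derive x 1 (fun y => f (g y)) (a * b).
Proof. by move=> Df Dg; exact: (is_derive1_comp Df Dg). Qed.

Lemma derpow f x c a : 0 < f x -> is_derive x 1 f a ->
  is_derive x 1 (fun y => f y `^ c) (c * f x `^ (c - 1) * a).
Proof.
by move=> fx0 Df; exact: (der_comp (is_derive1_powR c fx0) Df).
Qed.

Lemma dersqrt f x a : 0 < f x -> is_derive x 1 f a ->
  is_derive x 1 (fun y => Num.sqrt (f y)) ((2 * Num.sqrt (f x))^-1 * a).
Proof.
by move=> fx0 Df; exact: (der_comp (is_derive1_sqrt fx0) Df).
Qed.

Lemma derV f x a : f x != 0 -> is_derive x 1 f a ->
  is_derive x 1 (fun y => (f y)^-1) (- a / f x ^+ 2).
Proof.
move=> fx0 Df; apply: (is_derive_eq (is_deriveV fx0 Df)).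
by rewrite /GRing.scale /= mulNr mulNr mulrC.
Qed.

Lemma der_continuous f df x : is_derive x 1 f (df x) -> {for x, continuous f}.
Proof. by case=> D _; apply/differentiable_continuous/derivable1_diffP. Qed.

Lemma mean_value f df x y : x < y ->
  (forall z, x <= z <= y -> is_derive z 1 f (df z)) ->
  exists2 z, x < z < y & f y - f x = df z * (y - x).
Proof.
move=> xy D; have [||z zxy ->] := @MVT R f df x y xy.
- by move=> z; rewrite in_itv /= => /andP[xz zy]; apply: D; rewrite !ltW.
- apply: derivable_within_continuous => z; rewrite in_itv /= => zxy.
  by have [] := D z zxy.
- by exists z => //; move: zxy; rewrite in_itv.
Qed.

Lemma der_ge0_le f df x y : x <= y ->
  (forall z, x <= z <= y -> is_derive z 1 f (df z)) ->
  (forall z, x <= z <= y -> 0 <= df z) -> f x <= f y.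
Proof.
rewrite le_eqVlt => /predU1P[->//|xy] D D0.
have [z /andP[xz zy] E] := mean_value xy D.
by rewrite -subr_ge0 E mulr_ge0 ?subr_ge0 ?(ltW xy) // D0 // !ltW.
Qed.

Lemma der_le0_le f df x y : x <= y ->
  (forall z, x <= z <= y -> is_derive z 1 f (df z)) ->
  (forall z, x <= z <= y -> df z <= 0) -> f y <= f x.
Proof.
move=> xy D D0; rewrite -lerN2.
apply: (@der_ge0_le (fun t => - f t) (fun t => - df t)) => // z zxy.
  by apply: derN; exact: D.
by rewrite oppr_ge0 D0.
Qed.

Lemma der_gt0_lt f df x y : x < y ->
  (forall z, x <= z <= y -> is_derive z 1 f (df z)) ->
  (forall z, x <= z <= y -> 0 < df z) -> f x < f y.
Proof.
move=> xy D D0.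
have [z /andP[xz zy] E] := mean_value xy D.
by rewrite -subr_gt0 E mulr_gt0 ?subr_gt0 // D0 // !ltW.
Qed.

End RealCalculus.

(** * The Euclidean norm and its square along coordinate lines *)

Section EuclideanNorm.
Context {R : realType} {N : nat}.
Implicit Types (x y : 'rV[R]_N) (a h : R) (i : 'I_N).

Lemma enorm_ge0 x : 0 <= enorm x. Proof. exact: sqrtr_ge0. Qed.

Lemma enorm2 x : enorm x ^+ 2 = \sum_(i < N) x ord0 i ^+ 2.
Proof. by rewrite sqr_sqrtr // sumr_ge0 // => i _; exact: sqr_ge0. Qed.

Lemma enormZ a x : enorm (a *: x) = `|a| * enorm x.
Proof.
rewrite /enorm -sqrtr_sqr -sqrtrM ?sqr_ge0 // mulr_sumr.
by congr Num.sqrt; apply: eq_bigr => i _; rewrite mxE exprMn.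
Qed.

Lemma coord_le_enorm x i : `|x ord0 i| <= enorm x.
Proof.
rewrite -sqrtr_sqr ler_wsqrtr // (bigD1 i) //= lerDl sumr_ge0 // => j _.
exact: sqr_ge0.
Qed.

Lemma enorm_delta i : enorm (delta_mx ord0 i : 'rV[R]_N) = 1.
Proof.
rewrite /enorm (bigD1 i) //= mxE !eqxx expr1n big1 ?addr0 ?sqrtr1 // => j ji.
by rewrite mxE (negbTE ji) andbF expr0n.
Qed.

Lemma enorm_gt0 x : (0 < enorm x) = (x != 0).
Proof.
apply/idP/idP => [x0|].
  apply: contraTneq x0 => ->; rewrite -leNgt /enorm big1 ?sqrtr0 // => i _.
  by rewrite mxE expr0n.
apply: contra_neqT => x0; apply/rowP => i; rewrite mxE.
by apply/eqP; rewrite -normr_eq0 eq_le normr_ge0 andbT (le_trans (coord_le_enorm x i)) // leNgt.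
Qed.

Lemma enorm2_line x i h :
  enorm (h *: delta_mx ord0 i + x) ^+ 2 = enorm x ^+ 2 + (2 * x ord0 i * h + h * h).
Proof.
rewrite !enorm2 (bigD1 i) //= [in RHS](bigD1 i) //= !mxE !eqxx mulr1.
rewrite (eq_bigr (fun j => x ord0 j ^+ 2)); first by rewrite !expr2; ring.
by move=> j ji; rewrite !mxE (negbTE ji) andbF mulr0 add0r.
Qed.

End EuclideanNorm.

(** * Directional derivatives as derivatives in one real variable *)

Section LineDerivative.
Context {R : realType} {N : nat}.
Implicit Types (f g : 'rV[R]_N -> R) (x v : 'rV[R]_N).

Lemma is_derive_lineP f x v (a : R) :
  is_derive x v f a <-> is_derive (0 : R) 1 (fun h : R => f (h *: v + x)) a.
Proof.
have E : (fun h : R => h^-1 *: ((f \o shift x) (h *: v) - f x)) =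
  (fun h : R => h^-1 *: (((fun h : R => f (h *: v + x)) \o shift (0 : R)) (h *: (1 : R)) -
     f ((0 : R) *: v + x))).
  apply/funext => h /=; rewrite scale0r add0r addr0.
  by rewrite [h *: 1]mulr1.
by split=> -[D V]; split; move: D V; rewrite /derivable /derive E.
Qed.

Lemma der_shift (f : R -> R) (r a : R) :
  is_derive (0 : R) 1 (fun h : R => f (h + r)) a <-> is_derive r 1 f a.
Proof.
split=> D.
  have := @der_comp R (fun h => f (h + r)) (fun y => y - r) r a 1.
  rewrite subrr => /(_ D); have -> : (fun y => f (y - r + r)) = f.
    by apply/funext => y; rewrite subrK.
  rewrite mulr1; apply.
  by apply: (is_derive_eq (derB (derid r) (dercst r r))); rewrite subr0.
have := @der_comp R f (fun h => h + r) 0 a 1.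
rewrite add0r mulr1; apply => //.
by apply: (is_derive_eq (derD (derid 0) (dercst r 0))); rewrite addr0.
Qed.

(** Along a coordinate line the norm is the square root of a quadratic polynomial in the parameter,
    positive at 0 because x is not the origin. *)
Lemma is_derive_radial (g : R -> R) x i (a : R) : 0 < enorm x ->
  is_derive (enorm x) 1 g a ->
  is_derive x (delta_mx ord0 i : 'rV[R]_N) (fun y => g (enorm y))
    (a * (x ord0 i / enorm x)).
Proof.
move=> x0 Dg; apply/is_derive_lineP.
have E h : enorm (h *: (delta_mx ord0 i : 'rV[R]_N) + x) =
    Num.sqrt (enorm x ^+ 2 + (2 * x ord0 i * h + h * h)).
  by rewrite -enorm2_line sqrtr_sqr ger0_norm // enorm_ge0.
rewrite (funext (fun h => congr1 g (E h))).
have S0 : Num.sqrt (enorm x ^+ 2 + (2 * x ord0 i * 0 + 0 * 0)) = enorm x.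
  by rewrite !mulr0 !addr0 sqrtr_sqr ger0_norm // enorm_ge0.
apply: der_comp; first by rewrite S0.
have p0 : 0 < enorm x ^+ 2 + (2 * x ord0 i * 0 + 0 * 0).
  by rewrite !mulr0 !addr0 exprn_gt0.
have D := dersqrt (f := fun h => enorm x ^+ 2 + (2 * x ord0 i * h + h * h)) p0 (derD (dercst (enorm x ^+ 2) 0)
  (derD (derZ (2 * x ord0 i) (derid 0)) (derM (derid 0) (derid 0)))).
apply: (is_derive_eq D); rewrite S0.
by field; rewrite gt_eqF.
Qed.

Lemma is_derive_coord x (i : 'I_N) :
  is_derive x (delta_mx ord0 i : 'rV[R]_N) (fun y => y ord0 i) 1.
Proof.
apply/is_derive_lineP.
rewrite (_ : (fun h => _) = (fun h => h + x ord0 i)).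
  by apply: (is_derive_eq (derD (derid 0) (dercst (x ord0 i) 0))); rewrite addr0.
by apply/funext => h; rewrite !mxE !eqxx mulr1.
Qed.

End LineDerivative.

(** * The radial equation *)

Section RadialODE.
Context {R : realType}.
Implicit Types r s t z a b k C th : R.
Variables (n p : R) (U w : R -> R).
Hypothesis n_gt2 : 2 < n.
Hypothesis p_super : n + 2 < p * (n - 2).
Let E (r : R) : R := Num.sqrt (1 + w r ^+ 2).
Let v (r : R) : R := w r / E r.
Hypothesis U_gt0 : forall r : R, 0 < r -> 0 < U r.
Hypothesis U_der : forall r : R, 0 < r -> is_derive r 1 U (- v r).
Hypothesis w_der : forall r : R, 0 < r ->
  is_derive r 1 w (U r `^ p - (n - 1) / r * w r).
Hypothesis U_cvg0 : forall e : R, 0 < e -> exists M : R, forall r : R, M < r -> U r < e.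
Hypothesis w_bound0 : exists C d : R, 0 < d /\ forall r : R, 0 < r < d -> `|w r| <= C.

Let p_gt1 : 1 < p.
Proof.
by rewrite -(@ltr_pM2r _ (n - 2)) ?subr_gt0 // mul1r; apply: lt_trans p_super; have ? := n_gt2; lra.
Qed.

Ltac lra_np := have ? := p_gt1; have ? := n_gt2; have ? := p_super; lra.

Let n1_ge1 : 1 <= n - 1.
Proof. by lra_np. Qed.

Let E2 r : E r ^+ 2 = 1 + w r ^+ 2.
Proof. by rewrite /E sqr_sqrtr // addr_ge0 ?sqr_ge0. Qed.

Let E_ge1 r : 1 <= E r.
Proof. by rewrite -(@ler_sqr R) ?nnegrE ?sqrtr_ge0 // E2 expr1n lerDl sqr_ge0. Qed.

Let E_gt0 r : 0 < E r. Proof. exact: lt_le_trans (E_ge1 r). Qed.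

Let E_der r : 0 < r ->
  is_derive r 1 E (v r * (U r `^ p - (n - 1) / r * w r)).
Proof.
move=> r0; have e0 : 0 < 1 + w r * w r by rewrite -expr2 -E2 exprn_gt0.
have Dw := w_der r0.
have := dersqrt (f := fun y => 1 + w y * w y) e0 (derD (dercst 1 r) (derM Dw Dw)).
have -> : (fun y => Num.sqrt (1 + w y * w y)) = E.
  by apply/funext => y; rewrite /E expr2.
move=> H; apply: (is_derive_eq H).
have -> : Num.sqrt (1 + w r * w r) = E r by rewrite /E expr2.
by rewrite /v; have := E_gt0 r => h; field; rewrite !gt_eqF.
Qed.

(** Up to a constant, the flux of the normalised gradient through the sphere of radius r; its
    derivative is the source term alone. *)
Let Q (r : R) : R := r `^ (n - 1) * w r.

Let Q_der r : 0 < r -> is_derive r 1 Q (r `^ (n - 1) * U r `^ p).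
Proof.
move=> r0; have := derM (derpow (n - 1) r0 (derid r)) (w_der r0).
move=> H; apply: (is_derive_eq H).
by rewrite powR_sub1 //; field; rewrite gt_eqF.
Qed.

(** [Q] is strictly increasing and tends to 0 at the origin, because w stays bounded there while
    r^(n-1) vanishes. A value [Q r] <= 0 would keep [Q] below a fixed negative number near 0. *)
Lemma flux_gt0 r : 0 < r -> 0 < w r.
Proof.
have Qlt s t : 0 < s -> s < t -> Q s < Q t.
  move=> s0 st; apply: (@der_gt0_lt _ Q (fun r => r `^ (n - 1) * U r `^ p)) => //.
    by move=> z /andP[sz _]; apply: Q_der; exact: lt_le_trans sz.
  move=> z /andP[sz _]; have z0 : 0 < z by exact: lt_le_trans sz.
  by rewrite mulr_gt0 // powR_gt0 // U_gt0.
move=> r0; suff : 0 < Q r by rewrite /Q pmulr_rgt0 // powR_gt0.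
rewrite ltNge; apply/negP => Qr.
have [C [d [d0 Cd]]] := w_bound0.
set q := - Q (r / 2).
have q0 : 0 < q.
  rewrite oppr_gt0; apply: lt_le_trans Qr; apply: Qlt; first by rewrite divr_gt0.
  by rewrite ltr_pdivrMr // ltr_pMr // (ltr_nat _ 1 2).
have C0 : 0 <= C.
  by apply: le_trans (Cd (d / 2) _); rewrite ?normr_ge0 // ; apply/andP; split; lra_np.
(* The four bounds on s give in turn s^(n-1) <= s, [|w s| <= C], [Q s <= - q] and s C <= q / 2; the
   first, second and fourth contradict the third. *)
pose s := Num.min (Num.min 1 (d / 2)) (Num.min (r / 4) (q / (2 * (C + 1)))).
have s0 : 0 < s.
  by rewrite /s !lt_min !divr_gt0 ?mulr_gt0 ?ltr01 //; lra_np.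
have [s1 sd sr sq] : [/\ s <= 1, s <= d / 2, s <= r / 4 & s <= q / (2 * (C + 1))].
  by rewrite /s !ge_min !lexx ?orbT.
have Qs : Q s <= - q by rewrite opprK ltW // Qlt //; lra_np.
have : `|Q s| <= s * C.
  rewrite /Q normrM (ger0_norm (powR_ge0 _ _)) ler_pM ?powR_ge0 //.
    apply: ge1r_powR; [by rewrite s0 s1|exact: n1_ge1].
  by apply: Cd; rewrite s0 /=; lra_np.
have : s * C <= q / 2.
  apply: le_trans (_ : q / (2 * (C + 1)) * C <= _); first by rewrite ler_wpM2r.
  have -> : q / (2 * (C + 1)) * C = q / 2 * (C / (C + 1)) by field; lra_np.
  by rewrite ler_piMr ?ler_pdivrMr; lra_np.
by have := ler_norm (- Q s); rewrite normrN; lra_np.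
Qed.

Let v_gt0 r : 0 < r -> 0 < v r.
Proof. by move=> r0; rewrite divr_gt0 // flux_gt0. Qed.

Let v_le_w r : 0 < r -> v r <= w r.
Proof. by move=> r0; rewrite ler_pdivrMr // ler_peMr // ltW // flux_gt0. Qed.

Lemma U_nincr s t : 0 < s -> s <= t -> U t <= U s.
Proof.
move=> s0 st; apply: (@der_le0_le _ U (fun r => - v r)) => // z /andP[sz _].
  by apply: U_der; exact: lt_le_trans sz.
by rewrite oppr_le0 ltW // v_gt0 //; exact: lt_le_trans sz.
Qed.

(** As U decreases, the derivative of [Q] on [r/2, r] is at least t^(n-1) U(r)^p. Integration starts
    at r/2, away from the singular origin, and (r/2)^n <= r^n / 2 accounts for the factor 2 in the
    denominator. *)
Lemma flux_lower r : 0 < r -> r * U r `^ p / (2 * n) <= w r.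
Proof.
move=> r0; set A := U r `^ p.
have A0 : 0 < A by rewrite powR_gt0 // U_gt0.
have h2 : 0 < r / 2 by rewrite divr_gt0.
have h2r : r / 2 <= r by lra_np.
have : Q (r / 2) - A / n * (r / 2) `^ n <= Q r - A / n * r `^ n.
  apply: (@der_ge0_le _ (fun t => Q t - A / n * t `^ n)
    (fun t => t `^ (n - 1) * U t `^ p - A / n * (n * t `^ (n - 1) * 1)) _ _ h2r).
  - move=> z /andP[sz _]; have z0 : 0 < z by exact: lt_le_trans sz.
    by apply: derB; [exact: Q_der|apply: derZ; exact: (derpow _ z0 (derid z))].
  - move=> z /andP[sz zr]; have z0 : 0 < z by exact: lt_le_trans sz.
    have -> : z `^ (n - 1) * U z `^ p - A / n * (n * z `^ (n - 1) * 1) =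
      z `^ (n - 1) * (U z `^ p - A) by field; lra_np.
    rewrite mulr_ge0 ?powR_ge0 // subr_ge0 powR_le //; first lra_np.
      by rewrite ltW // U_gt0.
    exact: U_nincr.
move=> H.
have Q0 : 0 < Q (r / 2) by rewrite mulr_gt0 ?powR_gt0 ?flux_gt0.
have rn : (r / 2) `^ n <= r `^ n / 2.
  rewrite powRM ?(ltW r0) // ler_wpM2l ?powR_ge0 // ge1r_powR //; last lra_np.
  by apply/andP; split; lra_np.
have H1 : A / n * (r / 2) `^ n <= A / n * (r `^ n / 2).
  by rewrite ler_wpM2l // divr_ge0 //; lra_np.
have H2 : A / n * (r `^ n / 2) <= Q r by lra_np.
move: H2; have -> : Q r = r `^ n / r * w r by rewrite /Q powR_sub1.
have rn0 : 0 < r `^ n by rewrite powR_gt0.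
have -> : A / n * (r `^ n / 2) = r `^ n / r * (r * A / (2 * n)).
  by field; rewrite !gt_eqF //; lra_np.
by rewrite ler_pM2l // divr_gt0.
Qed.

Let F (r : R) : R := U r `^ (p + 1) / (p + 1).

Let F_der r : 0 < r -> is_derive r 1 F (- (v r * U r `^ p)).
Proof.
move=> r0; have := derM (derpow (p + 1) (U_gt0 r0) (U_der r0)) (dercst (p + 1)^-1 r).
move=> H; apply: (is_derive_eq H).
have -> : p + 1 - 1 = p by lra_np.
by field; lra_np.
Qed.

Let F_gt0 r : 0 < r -> 0 < F r.
Proof. by move=> r0; rewrite divr_gt0 ?powR_gt0 ?U_gt0 //; lra_np. Qed.

(** Since [E] = 1 / sqrt (1 - U'^2), [E - 1] is a relativistic kinetic energy and [F] the potential;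
    only the friction term (n-1)/r w contributes to the derivative. *)
Let H (r : R) : R := E r - 1 + F r.

Let H_der r : 0 < r -> is_derive r 1 H (- ((n - 1) / r * v r * w r)).
Proof.
move=> r0; have := derD (derB (E_der r0) (dercst 1 r)) (F_der r0).
by move=> D; apply: (is_derive_eq D); ring.
Qed.

(** Monotonicity of [H] bounds [E] by [1 + H 1] on [1, oo), so v = w / E inherits the lower bound on
    w. *)
Lemma slope_lower : exists k, 0 < k /\
  forall r : R, 1 <= r -> k * r * U r `^ p <= v r.
Proof.
have K0 : 0 < 1 + H 1 by rewrite /H; have := F_gt0 ltr01; have := E_gt0 1; lra_np.
exists ((2 * n * (1 + H 1))^-1); split; first by rewrite invr_gt0 !mulr_gt0 //; lra_np.
move=> r r1; have r0 : 0 < r by lra_np.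
have EK : E r <= 1 + H 1.
  have : H r <= H 1.
    apply: (@der_le0_le _ H (fun r => - ((n - 1) / r * v r * w r))) => // z /andP[z1 _].
      by apply: H_der; lra_np.
    have z0 : 0 < z by lra_np.
    by rewrite oppr_le0 mulr_ge0 ?(ltW (flux_gt0 z0)) // mulr_ge0 ?(ltW (v_gt0 z0)) //
      divr_ge0 //; lra_np.
  by rewrite {1}/H; have := F_gt0 r0; lra_np.
rewrite /v ler_pdivlMr //; apply: le_trans (flux_lower r0).
have -> : r * U r `^ p / (2 * n) = (2 * n * (1 + H 1))^-1 * r * U r `^ p * (1 + H 1).
  by field; lra_np.
rewrite ler_wpM2l // !mulr_ge0 ?invr_ge0 ?powR_ge0 //; last lra_np.
by rewrite !mulr_ge0 //; lra_np.
Qed.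

(** The derivative of U^(1-th) is (th-1) v U^(-th) >= (th-1) k r, so U^(1-th) grows at least
    quadratically. The exponent is left free: th = p gives the general upper bound, th < p a
    strictly faster rate. *)
Lemma decay_of_slope th k r0 : 1 < th -> 0 < k -> 0 < r0 ->
  (forall r : R, r0 <= r -> k * r * U r `^ th <= v r) ->
  exists C r1, [/\ 0 < C, r0 <= r1 &
    forall r : R, r1 <= r -> U r <= C * r `^ (- (2 / (th - 1)))].
Proof.
move=> th1 k0 r00 kv.
(* Integration gives (th-1) k (r^2 - r0^2) / 2, and r >= 2 r0 makes this at least (th-1) k r^2 (1 -
   1/4) / 2. *)
pose c := (th - 1) * k * (3 / 8).
have c0 : 0 < c by rewrite !mulr_gt0 //; lra_np.
pose a := (th - 1)^-1.
have a0 : 0 < a by rewrite invr_gt0; lra_np.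
exists (c `^ (- a)), (2 * r0); split; [by rewrite powR_gt0|lra_np|].
move=> r rr; have r_gt0 : 0 < r by lra_np.
pose g t := U t `^ (1 - th) - (th - 1) * k / 2 * (t * t).
pose dg t := (1 - th) * U t `^ (1 - th - 1) * (- v t) - (th - 1) * k / 2 * (1 * t + t * 1).
have : g r0 <= g r.
  apply: (@der_ge0_le _ g dg) => //; first lra_np.
    move=> z /andP[z1 _]; have z0 : 0 < z by lra_np.
    apply: derB; first by apply: derpow; [exact: U_gt0|exact: U_der].
    by apply: derZ; apply: derM; exact: derid.
  move=> z /andP[z1 _]; have z0 : 0 < z by lra_np.
  have uz : 0 < U z `^ th by rewrite powR_gt0 // U_gt0.
  have -> : dg z = (th - 1) * (v z / U z `^ th - k * z).
    rewrite /dg (_ : 1 - th - 1 = - th); last lra_np.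
    by rewrite powRN; field; rewrite gt_eqF.
  rewrite mulr_ge0 ?subr_ge0 //; first lra_np.
  by rewrite (ler_pdivlMr _ _ uz) kv.
rewrite /g => H1.
have g0 : 0 < U r0 `^ (1 - th) by rewrite powR_gt0 // U_gt0.
have H2 : c * r ^+ 2 <= U r `^ (1 - th).
  have : (th - 1) * k / 2 * (r0 * r0) <= (th - 1) * k / 2 * (r * r / 4).
    by rewrite ler_wpM2l ?divr_ge0 ?mulr_ge0 //; [lra_np|lra_np|nra].
  by rewrite /c expr2; lra_np.
have -> : U r = (U r `^ (1 - th)) `^ (- a).
  rewrite -powRrM (_ : (1 - th) * - a = 1) ?powRr1 ?ltW ?U_gt0 //.
  by rewrite /a; field; lra_np.
have -> : c `^ (- a) * r `^ (- (2 / (th - 1))) = (c * r ^+ 2) `^ (- a).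
  rewrite powRM ?(ltW c0) ?sqr_ge0 // -powR_mulrn ?ltW // -powRrM.
  by rewrite mulrN.
by apply: powR_opp_le => //; [exact: ltW|rewrite mulr_gt0 // exprn_gt0].
Qed.

Lemma decay_upper : exists C r1, [/\ 0 < C, 1 <= r1 &
  forall r : R, r1 <= r -> U r <= C * r `^ (- (2 / (p - 1)))].
Proof. by have [k [k0 kv]] := slope_lower; exact: decay_of_slope kv. Qed.

(** The difference [D] of the two sides is nondecreasing because v <= w. A positive value of [D]
    would persist and keep U away from 0 at infinity. *)
Lemma decay_of_flux b C r0 : 2 < b -> 0 < r0 ->
  (forall r : R, r0 <= r -> w r <= C * r `^ (1 - b)) ->
  forall r : R, r0 <= r -> U r <= C / (b - 2) * r `^ (2 - b).
Proof.
move=> b2 r00 wC.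
have C0 : 0 < C.
  by have := lt_le_trans (flux_gt0 r00) (wC _ (lexx _)); rewrite pmulr_lgt0 // powR_gt0.
pose D t := U t - C / (b - 2) * t `^ (2 - b).
move=> r rr; rewrite -subr_le0 -/(D r) leNgt; apply/negP => Dr.
have [M MU] := U_cvg0 Dr.
pose s := Num.max (M + 1) r.
have sr : r <= s by rewrite le_max lexx orbT.
have sM : M < s by rewrite lt_max ltrDl ltr01.
have s0 : 0 < s by lra_np.
have : D r <= D s.
  apply: (@der_ge0_le _ D (fun t => - v t - C / (b - 2) * ((2 - b) * t `^ (2 - b - 1) * 1))) => //.
    move=> z /andP[z1 _]; have z0 : 0 < z by lra_np.
    by apply: derB; [exact: U_der|apply: derZ; exact: (derpow _ z0 (derid z))].
  move=> z /andP[z1 _]; have z0 : 0 < z by lra_np.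
  have -> : - v z - C / (b - 2) * ((2 - b) * z `^ (2 - b - 1) * 1) = C * z `^ (1 - b) - v z.
    by rewrite (_ : 2 - b - 1 = 1 - b); [field; lra_np|lra_np].
  by rewrite subr_ge0; apply: le_trans (v_le_w z0) (wC _ _); lra_np.
have : 0 < C / (b - 2) * s `^ (2 - b) by rewrite mulr_gt0 ?powR_gt0 ?divr_gt0 //; lra_np.
by have := MU _ sM; rewrite [D s]/D; lra_np.
Qed.

(** * Bootstrapping the decay rate *)

Let w_Q r : 0 < r -> w r = Q r * r `^ (1 - n).
Proof.
move=> r0; rewrite /Q (_ : 1 - n = - (n - 1)); last lra_np.
by rewrite powRN; field; rewrite gt_eqF // powR_gt0.
Qed.

Let Q_der_le C a r : 0 < r -> 0 < C -> U r <= C * r `^ (- a) ->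
  r `^ (n - 1) * U r `^ p <= C `^ p * r `^ (n - a * p - 1).
Proof.
move=> r0 C0 UC.
have -> : n - a * p - 1 = n - 1 + - a * p by lra_np.
rewrite (powR_addp (n - 1) _ r0) mulrCA ler_wpM2l ?powR_ge0 // powRrM -powRM ?powR_ge0 ?(ltW C0) //.
by rewrite powR_le // ?(ltW (U_gt0 _)) //; lra_np.
Qed.

(** Here the bound r^(n - a p - 1) on the derivative of [Q] is not integrable at infinity, so [Q]
    may grow like r^(n - a p). *)
Lemma flux_sub a C r0 : 0 < C -> 0 < r0 -> a * p < n ->
  (forall r : R, r0 <= r -> U r <= C * r `^ (- a)) ->
  exists C', 0 < C' /\ forall r : R, r0 <= r -> w r <= C' * r `^ (1 - a * p).
Proof.
move=> C0 r00 an UC; set b := a * p.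
pose c := C `^ p / (n - b).
have c0 : 0 < c by rewrite divr_gt0 ?powR_gt0 //; rewrite /b; lra_np.
exists (Q r0 / r0 `^ (n - b) + c); split.
  by rewrite addr_gt0 // divr_gt0 ?powR_gt0 // mulr_gt0 ?powR_gt0 ?flux_gt0.
move=> r rr; have r_gt0 : 0 < r by lra_np.
rewrite w_Q // (_ : 1 - b = (n - b) + (1 - n)); last lra_np.
rewrite (powR_addp (n - b) _ r_gt0) mulrA ler_wpM2r ?powR_ge0 // mulrDl.
have : Q r - c * r `^ (n - b) <= Q r0 - c * r0 `^ (n - b).
  apply: (@der_le0_le _ (fun t => Q t - c * t `^ (n - b)) (fun t => t `^ (n - 1) * U t `^ p
    - c * ((n - b) * t `^ (n - b - 1) * 1))) => //.
    move=> z /andP[z1 _]; have z0 : 0 < z by lra_np.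
    by apply: derB; [exact: Q_der|apply: derZ; exact: (derpow _ z0 (derid z))].
  move=> z /andP[z1 _]; have z0 : 0 < z by lra_np.
  rewrite subr_le0 (_ : c * _ = C `^ p * z `^ (n - b - 1)); last by rewrite /c; field; rewrite /b; lra_np.
  by apply: Q_der_le => //; apply: UC; lra_np.
have : Q r0 <= Q r0 / r0 `^ (n - b) * r `^ (n - b).
  rewrite mulrAC ler_pdivlMr ?powR_gt0 // ler_wpM2l ?powR_le //.
  - by rewrite ltW // mulr_gt0 ?powR_gt0 ?flux_gt0.
  - by rewrite /b; lra_np.
  - exact: ltW.
have : 0 < c * r0 `^ (n - b) by rewrite mulr_gt0 ?powR_gt0.
by lra_np.
Qed.

(** Here the bound on the derivative of [Q] is integrable at infinity, so [Q] stays bounded and w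
    decays at the harmonic rate. *)
Lemma flux_sup a C r0 : 0 < C -> 0 < r0 -> n < a * p ->
  (forall r : R, r0 <= r -> U r <= C * r `^ (- a)) ->
  exists C', 0 < C' /\ forall r : R, r0 <= r -> w r <= C' * r `^ (1 - n).
Proof.
move=> C0 r00 an UC; set b := a * p.
pose c := C `^ p / (b - n).
have c0 : 0 < c by rewrite divr_gt0 ?powR_gt0 //; rewrite /b; lra_np.
exists (Q r0 + c * r0 `^ (n - b)); split.
  by rewrite addr_gt0 // mulr_gt0 ?powR_gt0 ?flux_gt0.
move=> r rr; have r_gt0 : 0 < r by lra_np.
rewrite w_Q // ler_wpM2r ?powR_ge0 //.
have : Q r + c * r `^ (n - b) <= Q r0 + c * r0 `^ (n - b).
  apply: (@der_le0_le _ (fun t => Q t + c * t `^ (n - b)) (fun t => t `^ (n - 1) * U t `^ p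
    + c * ((n - b) * t `^ (n - b - 1) * 1))) => //.
    move=> z /andP[z1 _]; have z0 : 0 < z by lra_np.
    by apply: derD; [exact: Q_der|apply: derZ; exact: (derpow _ z0 (derid z))].
  move=> z /andP[z1 _]; have z0 : 0 < z by lra_np.
  rewrite (_ : c * _ = - (C `^ p * z `^ (n - b - 1))); last by rewrite /c; field; rewrite /b; lra_np.
  by rewrite subr_le0; apply: Q_der_le => //; apply: UC; lra_np.
have : 0 < c * r `^ (n - b) by rewrite mulr_gt0 ?powR_gt0.
by lra_np.
Qed.


(** The fixed point of a |-> a p - 2, the change of rate produced by integrating the equation twice.
    It is repelling because p > 1. *)
Let a0 : R := 2 / (p - 1).

Let a0p : a0 * p = 2 + a0.
Proof. by rewrite /a0; field; lra_np. Qed.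

Let a0_gt0 : 0 < a0.
Proof. by rewrite divr_gt0 //; lra_np. Qed.

Let a0_lt : a0 < n - 2.
Proof.
rewrite /a0 ltr_pdivrMr; last lra_np.
by have -> : (n - 2) * (p - 1) = p * (n - 2) - (n - 2); [ring|lra_np].
Qed.

(* Integrating the equation turns the rate a into a p - 2; lowering a slightly
   beforehand avoids the logarithmic case a p = n. *)
Lemma decay_step a C r0 : a0 < a -> a * p <= n -> 0 < C -> 1 <= r0 ->
  (forall r : R, r0 <= r -> U r <= C * r `^ (- a)) ->
  exists C', 0 < C' /\ forall r : R, r0 <= r ->
    U r <= C' * r `^ (- (a0 + (a - a0) * ((p + 1) / 2))).
Proof.
move=> aa ap C0 r01 UC.
(* Chosen so that a' - a0 = (a - a0) (p+1) / (2 p): the distance to a0 is then multiplied by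
   (p+1)/2, the mean of 1 and the full gain p. *)
pose a' := a - (a - a0) * ((p - 1) / (2 * p)).
have a'p : a' * p = 2 + (a0 + (a - a0) * ((p + 1) / 2)).
  by rewrite addrA -a0p /a'; field; lra_np.
have d0 : 0 < (a - a0) * ((p - 1) / (2 * p)).
  by rewrite mulr_gt0 ?divr_gt0 ?mulr_gt0 //; lra_np.
have d1 : 0 < (a - a0) * ((p + 1) / 2) by rewrite mulr_gt0 ?divr_gt0 //; lra_np.
have a'n : a' * p < n.
  apply: lt_le_trans ap; rewrite ltr_pM2r; last lra_np.
  by rewrite /a'; lra_np.
have UC' r : r0 <= r -> U r <= C * r `^ (- a').
  move=> rr; apply: le_trans (UC _ rr) _; rewrite ler_wpM2l ?(ltW C0) //.
  by apply: powR_le_exp; [exact: le_trans rr|rewrite /a'; lra_np].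
have r0_gt0 : 0 < r0 by lra_np.
have [C' [C'0 wC]] := flux_sub C0 r0_gt0 a'n UC'.
have b2 : 2 < a' * p by rewrite a'p; have := a0_gt0; lra_np.
exists (C' / (a' * p - 2)); split; first by rewrite divr_gt0 // subr_gt0.
move=> r rr; have := decay_of_flux b2 r0_gt0 wC rr.
have <- : 2 - a' * p = - (a0 + (a - a0) * ((p + 1) / 2)) by rewrite a'p; lra_np.
by [].
Qed.

(** Each bootstrap step multiplies a - a0 by l = (p+1)/2 > 1, so after finitely many steps a p
    exceeds n and the bounded-flux case applies. *)
Lemma fast_decay a C r0 : a0 < a -> 0 < C -> 1 <= r0 ->
  (forall r : R, r0 <= r -> U r <= C * r `^ (- a)) ->
  exists C', 0 < C' /\ forall r : R, r0 <= r ->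
    w r <= C' * r `^ (1 - n) /\ U r <= C' * r `^ (2 - n).
Proof.
pose l := (p + 1) / 2.
have fin : forall (k : nat) a C, a0 < a -> n < (a0 + (a - a0) * l ^+ k) * p ->
    0 < C -> 1 <= r0 -> (forall r : R, r0 <= r -> U r <= C * r `^ (- a)) ->
    exists C', 0 < C' /\ forall r : R, r0 <= r ->
      w r <= C' * r `^ (1 - n) /\ U r <= C' * r `^ (2 - n).
  { elim=> [|k IH] {}a {}C aa nk C0 r01 UC; have r0_gt0 : 0 < r0 by lra_np.
  (* Base case and induction step both finish at once when a p > n. The constant C' + C'/(n-2)
     serves both conclusions, C' for w and C'/(n-2) for U. *)
  all: have [pan|apn] := ltP n (a * p).
  1,3: have [C' [C'0 wC]] := flux_sup C0 r0_gt0 pan UC; exists (C' + C' / (n - 2)).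
  1,2: have D0 : 0 < C' / (n - 2) by rewrite divr_gt0 //; lra_np.
  1,2: split; [by rewrite addr_gt0|move=> r rr; split; last first].
  1,3: apply: le_trans (decay_of_flux n_gt2 r0_gt0 wC rr) _; rewrite ler_wpM2r ?powR_ge0 //; lra.
  1,2: apply: le_trans (wC _ rr) _; rewrite ler_wpM2r ?powR_ge0 //; lra.
    by move: nk; rewrite expr0 mulr1 subrKC ltNge apn.
  have [C' [C'0 UC']] := decay_step aa apn C0 r01 UC.
  apply: IH C'0 r01 UC'.
    by rewrite ltrDl mulr_gt0 ?divr_gt0 //; lra_np.
  by move: nk; rewrite exprS -/l addrAC subrr add0r mulrA. }
move=> aa C0 r01 UC.
have d0 : 0 < (a - a0) * (l - 1) by rewrite mulr_gt0 ?/l; lra_np.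
(* By Bernoulli l^k >= 1 + k (l-1), so this k already makes (a - a0) l^k larger than n. *)
pose k := Num.bound (n / ((a - a0) * (l - 1))).
apply: (fin k _ _ aa _ C0 r01 UC).
have : n / ((a - a0) * (l - 1)) < k%:R.
  by apply: archi_boundP; rewrite divr_ge0 ?(ltW d0) //; lra_np.
rewrite ltr_pdivrMr // => nk.
have l1 : 0 <= l - 1 by rewrite /l; lra_np.
have := bernoulli_ineq k l1; rewrite (_ : 1 + (l - 1) = l); last ring.
move=> lk; apply: lt_trans nk _.
have aa0 : 0 < a - a0 by rewrite subr_gt0.
have : k%:R * ((a - a0) * (l - 1)) <= (a - a0) * l ^+ k.
  by rewrite mulrCA ler_pM2l //; lra.
have := a0_gt0 => ha h.
have X0 : 0 < a0 + (a - a0) * l ^+ k.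
  by rewrite addr_gt0 // mulr_gt0 // exprn_gt0 // /l; lra_np.
have : a0 + (a - a0) * l ^+ k < (a0 + (a - a0) * l ^+ k) * p.
  by rewrite ltr_pMr.
by lra.
Qed.

(** * Vanishing of the flux and the Pohozaev functional *)

Lemma flux_cvg0 e : 0 < e -> exists M, 1 <= M /\ forall r : R, M <= r -> w r <= e.
Proof.
move=> e0; have [C [r1 [C0 r11 UC]]] := decay_upper.
have r1_gt0 : 0 < r1 by lra.
(* The critical rate lies in the growing-flux range because a0 < n - 2; it gives w = O(r^(-1-a0)),
   which is below C'/r. *)
have an : a0 * p < n by rewrite a0p; have := a0_lt; lra_np.
have [C' [C'0 wC]] := flux_sub C0 r1_gt0 an UC.
exists (Num.max r1 (C' / e)); split; first by rewrite le_max r11.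
move=> r; rewrite ge_max => /andP[rr rC]; apply: le_trans (wC _ rr) _.
have r_ge1 : 1 <= r by lra.
apply: (@le_trans _ _ (C' * r `^ (- 1))).
  rewrite ler_wpM2l ?(ltW C0) ?(ltW C'0) //; apply: powR_le_exp => //.
  by rewrite a0p; have := a0_gt0; lra.
rewrite powR_inv1; last lra.
rewrite ler_pdivrMr; last lra.
by rewrite mulrC -ler_pdivrMr.
Qed.

Let E_le r : 0 < r -> E r <= 1 + w r.
Proof.
move=> r0; rewrite -(@ler_sqr R) ?nnegrE ?sqrtr_ge0 //.
  by rewrite E2; have := flux_gt0 r0; nra.
by have := flux_gt0 r0; lra.
Qed.

Lemma E_cvg1 e : 1 < e -> exists M, 1 <= M /\ forall r : R, M <= r -> E r <= e.
Proof.
move=> e1; have e10 : 0 < e - 1 by rewrite subr_gt0.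
have [M [M1 wM]] := flux_cvg0 e10; exists M; split => // r Mr.
have r0 : 0 < r by lra.
by have := wM _ Mr; have := E_le r0; lra.
Qed.

Let kap : R := n / (p + 1).

Let kap_gt0 : 0 < kap. Proof. by rewrite divr_gt0 //; lra_np. Qed.

Let kap_lt : 2 * kap < n - 2.
Proof.
rewrite /kap mulrA ltr_pdivrMr; last lra_np.
by have -> : (n - 2) * (p + 1) = p * (n - 2) + (n - 2); [ring|lra_np].
Qed.

(* Pohozaev functional: the factor kap = n / (p + 1) cancels the U^(p+1) terms
   of P', whose sign for small w is then that of 2 kap - (n - 2) < 0. *)
Let P (r : R) : R := r `^ n * H r - kap * (Q r * U r).

Let E_sub1 r : E r - 1 = w r ^+ 2 / (E r + 1).
Proof.
have e0 := E_gt0 r.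
have -> : w r ^+ 2 = E r ^+ 2 - 1 by rewrite E2; ring.
by field; lra.
Qed.

Let P_der r : 0 < r -> is_derive r 1 P
  (r `^ (n - 1) * w r ^+ 2 * (n / (E r + 1) - (n - 1 - kap) / E r)).
Proof.
move=> r0; have D1 := derM (derpow n r0 (derid r)) (H_der r0).
have D2 := derZ kap (derM (Q_der r0) (U_der r0)).
apply: (is_derive_eq (derB D1 D2)).
have e0 := E_gt0 r; have u0 := U_gt0 r0.
rewrite /H E_sub1 /F /Q /v powR_add1 // powR_sub1 // /kap.
by field; rewrite !gt_eqF //; lra_np.
Qed.

Lemma P_nincr : exists r0, 1 <= r0 /\ forall s t, r0 <= s -> s <= t -> P t <= P s.
Proof.
(* The bracket in the derivative of [P] is nonpositive exactly when [E] is at most this threshold.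
   It exceeds 1 since 2 kap < n - 2, the supercritical condition. *)
pose e := (n - 1 - kap) / (1 + kap).
have k1 : 0 < 1 + kap by have := kap_gt0; lra.
have e1 : 1 < e by rewrite /e ltr_pdivlMr // mul1r; have := kap_lt; lra.
have [M [M1 EM]] := E_cvg1 e1; exists M; split => // s t Ms st.
apply: (@der_le0_le _ P (fun r => r `^ (n - 1) * w r ^+ 2 *
  (n / (E r + 1) - (n - 1 - kap) / E r))) => // z /andP[sz _].
  by apply: P_der; lra.
have z0 : 0 < z by lra.
apply: mulr_ge0_le0; first by rewrite mulr_ge0 ?powR_ge0 ?sqr_ge0.
have e0 := E_gt0 z; have e10 : 0 < E z + 1 by lra.
rewrite subr_le0 ler_pdivrMr // mulrAC ler_pdivlMr //.
have : E z * (1 + kap) <= n - 1 - kap by rewrite -ler_pdivlMr // EM; lra.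
by lra.
Qed.

(* P >= 0 makes w / (r U^th) nondecreasing once (p+1) E / (E+1) <= th. *)
Lemma fast_of_pohozaev_ge0 r0 : 1 <= r0 -> (forall r : R, r0 <= r -> 0 <= P r) ->
  exists a C r1, [/\ a0 < a, 0 < C, 1 <= r1 &
    forall r : R, r1 <= r -> U r <= C * r `^ (- a)].
Proof.
(* At E = 1 the quantity (p+1) E / (E+1) equals (p+1)/2; th is the midpoint of this value and p. The
   condition then reads E (p+3) <= 3 p + 1, which holds eventually. *)
move=> r01 P0; pose th := (3 * p + 1) / 4.
have th1 : 1 < th by rewrite /th; lra_np.
have thp : th < p by rewrite /th; lra_np.
have e1 : 1 < (3 * p + 1) / (p + 3) by rewrite ltr_pdivlMr; lra_np.
have [M [M1 EM]] := E_cvg1 e1.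
pose s0 := Num.max M r0.
have s01 : 1 <= s0 by rewrite le_max M1.
have s0M : M <= s0 by rewrite le_max lexx.
have s0r : r0 <= s0 by rewrite le_max lexx orbT.
pose T r := w r * (r^-1 * U r `^ (- th)).
have T0 : 0 < T s0.
  by rewrite !mulr_gt0 ?invr_gt0 ?powR_gt0 ?U_gt0 ?flux_gt0 //; lra.
have Tge r : s0 <= r -> T s0 <= T r.
  move=> sr; pose dT r := (U r `^ p - (n - 1) / r * w r) * (r^-1 * U r `^ (- th)) +
    w r * (- 1 / r ^+ 2 * U r `^ (- th) + r^-1 * (- th * U r `^ (- th - 1) * - v r)).
  apply: (@der_ge0_le _ T dT) => // z /andP[sz _]; have z0 : 0 < z by lra.
    apply: derM; first exact: w_der.
    have zn0 : z != 0 by rewrite gt_eqF.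
    apply: derM; first exact: (derV zn0 (derid z)).
    by apply: derpow; [exact: U_gt0|exact: U_der].
  have e0 := E_gt0 z; have u0 := U_gt0 z0; have w0 := flux_gt0 z0.
  have -> : dT z = U z `^ (- th) / z * (U z `^ p - n * w z / z + th * (w z * v z) / U z).
    by rewrite /dT powR_sub1 //; field; rewrite !gt_eqF.
  rewrite mulr_ge0 ?divr_ge0 ?powR_ge0 ?(ltW z0) //.
  (* This is [P z] >= 0 divided by z^(n-1); it absorbs the negative term - n w / z of the derivative
     of [T]. *)
  have Pz : kap * (w z * U z) <= z * (E z - 1 + F z).
    have : 0 <= P z by apply: P0; lra.
    rewrite /P subr_ge0 /Q /H powR_sub1 //.
    have -> : kap * (z `^ n / z * w z * U z) = z `^ n * (kap * (w z * U z) / z).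
      by field; rewrite gt_eqF.
    by rewrite ler_pM2l ?powR_gt0 // ler_pdivrMr // [leRHS]mulrC.
  have E1 : (p + 1) * (E z - 1) <= th * (w z * v z).
    rewrite E_sub1 /v.
    have -> : th * (w z * (w z / E z)) = w z ^+ 2 * (th / E z) by field; rewrite gt_eqF.
    rewrite mulrCA ler_wpM2l ?sqr_ge0 // ler_pdivrMr; last lra.
    rewrite mulrAC ler_pdivlMr //.
    have : E z * (p + 3) <= 3 * p + 1 by rewrite -ler_pdivlMr ?EM //; lra_np.
    by rewrite /th; lra.
  have : n * (w z * U z) <= z * (th * (w z * v z) + U z `^ p * U z).
    have -> : n * (w z * U z) = (p + 1) * (kap * (w z * U z)).
      by rewrite /kap; field; lra_np.
    apply: (@le_trans _ _ ((p + 1) * (z * (E z - 1 + F z)))).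
      by rewrite ler_wpM2l //; lra_np.
    have -> : (p + 1) * (z * (E z - 1 + F z)) = z * ((p + 1) * (E z - 1) + U z `^ p * U z).
      by rewrite /F powR_add1 //; field; lra_np.
    by rewrite ler_wpM2l ?(ltW z0) // lerD2r.
  move=> K; have -> : U z `^ p - n * w z / z + th * (w z * v z) / U z =
    (z * (th * (w z * v z) + U z `^ p * U z) - n * (w z * U z)) / (z * U z).
    by field; rewrite !gt_eqF.
  by rewrite divr_ge0 ?subr_ge0 // ltW // mulr_gt0.
have slope r : s0 <= r -> T s0 / 3 * r * U r `^ th <= v r.
  move=> sr; have r_gt0 : 0 < r by lra.
  have u0 : 0 < U r `^ th by rewrite powR_gt0 // U_gt0.
  (* The threshold (3 p + 1) / (p + 3) is below 3 for every p, so v and w differ by a factor of at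
     most 3. *)
  have e3 : E r <= 3.
    apply: (@le_trans _ _ ((3 * p + 1) / (p + 3))); first by apply: EM; lra.
    by rewrite ler_pdivrMr; lra_np.
  rewrite /v ler_pdivlMr //.
  have := Tge _ sr; rewrite {2}/T powRN.
  have -> : w r * (r^-1 * (U r `^ th)^-1) = w r / (r * U r `^ th).
    by field; rewrite !gt_eqF.
  rewrite ler_pdivlMr ?mulr_gt0 // => wT.
  have -> : T s0 / 3 * r * U r `^ th * E r = T s0 * (r * U r `^ th) * (E r / 3) by field.
  have X0 : 0 <= T s0 * (r * U r `^ th).
    by apply: mulr_ge0; [exact: ltW|apply: mulr_ge0; exact: ltW].
  by apply: le_trans wT; rewrite ler_piMr //; lra.
have k0 : 0 < T s0 / 3 by lra.
have s0_gt0 : 0 < s0 by lra.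
have [C [r1 [C0 sr1 UC]]] := decay_of_slope th1 k0 s0_gt0 slope.
exists (2 / (th - 1)), C, r1; split => //; last lra.
by rewrite /a0 ltr_pM2l // ltf_pV2 ?posrE; lra_np.
Qed.

(* P < 0 makes H U^(-2q) nonincreasing, whence v <= c1 U^q. *)
Lemma lower_of_pohozaev_lt0 r0 : 1 <= r0 -> (forall r : R, r0 <= r -> P r < 0) ->
  exists c, 0 < c /\ forall r : R, r0 <= r ->
    c * r `^ (- (2 * n / ((n - 1) * (p + 1) - 2 * n))) <= U r.
Proof.
move=> r01 P0; have r0_gt0 : 0 < r0 by lra.
have np : 2 * n < (n - 1) * (p + 1).
  have -> : (n - 1) * (p + 1) = p * (n - 2) + (n - 2) + (p + 1) by ring.
  lra_np.
(* Equivalently 2 q = (n-1)/kap, which makes the derivative of [L] a positive multiple of [P]. *)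
pose q := (p + 1) * (n - 1) / (2 * n).
have q1 : 1 < q by rewrite /q ltr_pdivlMr; lra_np.
pose L r := H r * U r `^ (- (2 * q)).
have H0 r : 0 < r -> 0 < H r.
  by move=> r_gt0; rewrite /H; have := F_gt0 r_gt0; have := E_ge1 r; lra.
have L0 : 0 < L r0 by rewrite mulr_gt0 ?H0 ?powR_gt0 ?U_gt0.
(* From v^2 <= 2 (E - 1) <= 2 H <= 2 L(r0) U^(2q) it suffices that c1^2 >= 2 L(r0); this choice
   avoids a square root. *)
pose c1 := 2 * L r0 + 1.
have vq r : r0 <= r -> v r <= c1 * U r `^ q.
  move=> rr; have r_gt0 : 0 < r by lra.
  have uq0 : 0 < U r `^ q by rewrite powR_gt0 // U_gt0.
  have : L r <= L r0.
    apply: (@der_le0_le _ L (fun r => - ((n - 1) / r * v r * w r) * U r `^ (- (2 * q)) +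
      H r * (- (2 * q) * U r `^ (- (2 * q) - 1) * - v r))) => // z /andP[sz _].
      have z0 : 0 < z by lra.
      by apply: derM; [exact: H_der|apply: derpow; [exact: U_gt0|exact: U_der]].
    have z0 : 0 < z by lra.
    have u0 := U_gt0 z0; have w0 := flux_gt0 z0; have v0 := v_gt0 z0.
    have -> : - ((n - 1) / z * v z * w z) * U z `^ (- (2 * q)) +
      H z * (- (2 * q) * U z `^ (- (2 * q) - 1) * - v z) =
      U z `^ (- (2 * q)) * v z * (n - 1) / (z * kap * U z) *
        (z * H z - kap * (w z * U z)).
      rewrite powR_sub1 // /q /kap; field.
      by rewrite !gt_eqF //; lra_np.
    apply: mulr_ge0_le0.
      apply: divr_ge0; apply: mulr_ge0; last exact: ltW.
      - by apply: mulr_ge0; [exact: powR_ge0|exact: ltW].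
      - by lra_np.
      - by apply: mulr_ge0; exact: ltW.
    have : P z <= 0 by apply/ltW/P0; lra.
    rewrite /P !subr_le0 /Q powR_sub1 //.
    have -> : kap * (z `^ n / z * w z * U z) = z `^ n * (kap * (w z * U z) / z).
      by field; rewrite gt_eqF.
    by rewrite ler_pM2l ?powR_gt0 // ler_pdivlMr // mulrC.
  rewrite {1}/L powRN ler_pdivrMr ?powR_gt0 ?U_gt0 // => HL.
  have u2 : U r `^ (2 * q) = (U r `^ q) ^+ 2.
    by rewrite -powR_mulrn ?powR_ge0 // -powRrM mulrC.
  rewrite u2 in HL.
  have c10 : 0 < c1 by rewrite /c1; lra.
  rewrite -(@ler_sqr R) ?nnegrE ?(ltW (v_gt0 _)) //; last by rewrite mulr_ge0 ?ltW.
  have v2 : v r ^+ 2 <= 2 * (E r - 1).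
    have e0 := E_gt0 r; rewrite E_sub1 /v expr_div_n mulrCA ler_wpM2l ?sqr_ge0 //.
    rewrite ler_pdivlMr; last lra.
    rewrite mulrC ler_pdivrMr ?exprn_gt0 //.
    by have := E_ge1 r; nra.
  have := F_gt0 r_gt0; have : v r ^+ 2 <= 2 * H r - 2 * F r by rewrite /H; lra.
  move=> v2' F0; apply: (@le_trans _ _ (2 * (L r0 * (U r `^ q) ^+ 2))); first lra.
  rewrite exprMn mulrA ler_wpM2r ?sqr_ge0 // /c1.
  by have := L0; nra.
pose G r := U r `^ (1 - q).
have G0 r : 0 < r -> 0 < G r by move=> r_gt0; rewrite powR_gt0 // U_gt0.
have c10 : 0 < c1 by rewrite /c1; lra.
(* The derivative of [G] is at most (q-1) c1, so G(r) <= G(r0) + (q-1) c1 r, and r >= 1 absorbs the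
   constant term. *)
pose c2 := G r0 + (q - 1) * c1.
have qc : 0 < (q - 1) * c1 by rewrite mulr_gt0 // subr_gt0.
have c20 : 0 < c2 by rewrite addr_gt0 // G0.
pose g := (q - 1)^-1.
have g0 : 0 < g by rewrite invr_gt0 subr_gt0.
have gE : 2 * n / ((n - 1) * (p + 1) - 2 * n) = g.
  by rewrite /g /q; field; lra_np.
exists (c2 `^ (- g)); split; first by rewrite powR_gt0.
move=> r rr; have r_gt0 : 0 < r by lra.
rewrite gE -powRM ?(ltW c20) ?(ltW r_gt0) //.
have -> : U r = G r `^ (- g).
  rewrite /G -powRrM (_ : (1 - q) * - g = 1) ?powRr1 ?ltW ?U_gt0 //.
  by rewrite /g; field; lra.
apply: powR_opp_le; [exact: ltW|exact: G0|].
have : G r - (q - 1) * c1 * r <= G r0 - (q - 1) * c1 * r0.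
  apply: (@der_le0_le _ (fun r => G r - (q - 1) * c1 * r)
    (fun r => (1 - q) * U r `^ (1 - q - 1) * - v r - (q - 1) * c1 * 1)) => // z /andP[sz _].
    have z0 : 0 < z by lra.
    exact: (derB (derpow _ (U_gt0 z0) (U_der z0)) (derZ _ (derid z))).
  have z0 : 0 < z by lra.
  have uq0 : 0 < U z `^ q by rewrite powR_gt0 // U_gt0.
  have -> : (1 - q) * U z `^ (1 - q - 1) * - v z - (q - 1) * c1 * 1 =
      (q - 1) / U z `^ q * (v z - c1 * U z `^ q).
    rewrite (_ : 1 - q - 1 = - q); last ring.
    by rewrite powRN; field; rewrite gt_eqF.
  apply: mulr_ge0_le0; first by rewrite divr_ge0 ?(ltW uq0) //; lra.
  by rewrite subr_le0; exact: vq.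
have : G r0 * 1 <= G r0 * r by rewrite ler_wpM2l ?(ltW (G0 _ _)) //; lra.
have : 0 < (q - 1) * c1 * r0 by rewrite mulr_gt0.
by rewrite /c2; lra.
Qed.

Lemma decay_dichotomy :
  (exists a C r0, [/\ a0 < a, 0 < C, 1 <= r0 &
    forall r : R, r0 <= r -> U r <= C * r `^ (- a)]) \/
  (exists c r0, [/\ 0 < c, 1 <= r0 & forall r : R, r0 <= r ->
    c * r `^ (- (2 * n / ((n - 1) * (p + 1) - 2 * n))) <= U r]).
Proof.
have [r0 [r01 Pn]] := P_nincr.
have [[r1 [r1r0 Pr1]]|Pge] := pselect (exists r1, r0 <= r1 /\ P r1 < 0).
  have r11 : 1 <= r1 by lra.
  have [|c [c0 cU]] := @lower_of_pohozaev_lt0 r1 r11.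
    by move=> r rr; apply: le_lt_trans (Pn _ _ _ rr) Pr1.
  by right; exists c, r1.
left; apply: (fast_of_pohozaev_ge0 r01) => r rr.
by rewrite leNgt; apply/negP => Pr; apply: Pge; exists r.
Qed.

End RadialODE.

(** * From the partial differential equation to the profile *)

Section RadialSolution.
Context {R : realType} {n' : nat}.
Let N := n'.+3.
Variables (p : R) (u : 'rV[R]_N -> R).
Hypothesis u_C2 : Ck 2 u.
Hypothesis u_radial : radial u.
Hypothesis u_spacelike : forall x, enorm (grad u x) < 1.
Hypothesis u_eq : forall x, mean_curvature u x + u x `^ p = 0.
Implicit Types (x y : 'rV[R]_N) (r : R).

Let e : 'rV[R]_N := delta_mx ord0 ord0.

(** Defined on the whole line, as the restriction of u to the first axis: evenness then gives U'(0)
    = 0, and differentiability at 0 is two-sided. *)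
Definition profile r : R := u (r *: e).

Definition slope r : R := - partial ord0 u (r *: e).

Definition slope' r : R := - partial ord0 (partial ord0 u) (r *: e).

Definition flux r : R := slope r / Num.sqrt (1 - slope r ^+ 2).

Let enorm_re r : 0 <= r -> enorm (r *: e) = r.
Proof. by move=> r0; rewrite enormZ enorm_delta mulr1 ger0_norm. Qed.

Lemma profileE x : u x = profile (enorm x).
Proof. by apply: u_radial; rewrite enorm_re ?enorm_ge0. Qed.

Let der_ray (f : 'rV[R]_N -> R) r : derivable f (r *: e) e ->
  is_derive r 1 (fun t => f (t *: e)) (partial ord0 f (r *: e)).
Proof.
move=> D; apply/der_shift.
rewrite (_ : (fun h => _) = (fun h : R => f (h *: e + r *: e))).
  by apply/is_derive_lineP; exact: DeriveDef.
by apply/funext => h; rewrite scalerDl.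
Qed.

Lemma profile_der r : is_derive r 1 profile (- slope r).
Proof. by rewrite opprK; apply: der_ray; case: u_C2 => _ /(_ ord0)[]. Qed.

Lemma slope_der r : is_derive r 1 slope (slope' r).
Proof.
apply: derN; apply: (@der_ray (partial ord0 u)).
by case: u_C2 => _ /(_ ord0)[_ [_ /(_ ord0)[]]].
Qed.

Lemma slope_lt1 r : `|slope r| < 1.
Proof.
apply: le_lt_trans (u_spacelike (r *: e)).
rewrite normrN; have := coord_le_enorm (grad u (r *: e)) ord0.
by rewrite /grad mxE.
Qed.

Let sq_gt0 r : 0 < 1 - slope r ^+ 2.
Proof. by rewrite subr_gt0 -real_normK ?num_real // expr_lt1 ?normr_ge0 ?slope_lt1. Qed.

Lemma slope_fluxE r : slope r = flux r / Num.sqrt (1 + flux r ^+ 2).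
Proof.
have s0 := sq_gt0 r; have q0 : 0 < Num.sqrt (1 - slope r ^+ 2) by rewrite sqrtr_gt0.
have -> : 1 + flux r ^+ 2 = (Num.sqrt (1 - slope r ^+ 2) ^- 1) ^+ 2.
  rewrite /flux expr_div_n exprVn sqr_sqrtr ?ltW //.
  by field; rewrite gt_eqF.
rewrite sqrtr_sqr ger0_norm ?invr_ge0 ?exprn_ge0 ?ltW // /flux expr1 invrK.
by rewrite divfK // gt_eqF.
Qed.

(** Only the existence of a derivative is extracted from the chain rule; its value is read off the
    partial differential equation. *)
Lemma flux_derivable r : exists a, is_derive r 1 flux a.
Proof.
have s0 := sq_gt0 r; have q0 : 0 < Num.sqrt (1 - slope r ^+ 2) by rewrite sqrtr_gt0.
have sE : (fun r => 1 - slope r ^+ 2) = (fun r => 1 - slope r * slope r).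
  by apply/funext => t; rewrite expr2.
have Ds := slope_der r.
have D1 : is_derive r 1 (fun r => 1 - slope r ^+ 2) (0 - (slope' r * slope r + slope r * slope' r)).
  by rewrite sE; exact: (derB (dercst 1 r) (derM Ds Ds)).
have D2 := dersqrt (f := fun r => 1 - slope r ^+ 2) s0 D1.
have qn0 : Num.sqrt (1 - slope r ^+ 2) != 0 by rewrite gt_eqF.
by eexists; exact: (derM Ds (derV (f := fun r => Num.sqrt (1 - slope r ^+ 2)) qn0 D2)).
Qed.

Lemma gradE x : x != 0 -> grad u x = (- slope (enorm x) / enorm x) *: x.
Proof.
rewrite -enorm_gt0 => x0; apply/rowP => i; rewrite !mxE /partial.
rewrite (_ : u = (fun y => profile (enorm y))); last by apply/funext => y; exact: profileE.
have := is_derive_radial i x0 (profile_der (enorm x)) => -[_ ->].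
by rewrite mulrA mulrAC.
Qed.

Let normal_gradE x i : x != 0 ->
  ((Num.sqrt (1 - enorm (grad u x) ^+ 2))^-1 *: grad u x) ord0 i =
  - (flux (enorm x) / enorm x) * x ord0 i.
Proof.
move=> xn0; have x0 : 0 < enorm x by rewrite enorm_gt0.
rewrite !gradE // enormZ normrM normrN normfV (ger0_norm (enorm_ge0 x)) divfK ?gt_eqF //.
rewrite real_normK ?num_real // !mxE /flux.
by field; rewrite !gt_eqF // sqrtr_gt0.
Qed.

(** Off the origin the normalised gradient is - (flux(|x|)/|x|) x, with divergence - (a + (N-1)
    flux(r)/r) where a is the derivative of the flux. The equation then determines a. *)
Lemma flux_der r : 0 < r ->
  is_derive r 1 flux (profile r `^ p - (N%:R - 1) / r * flux r).
Proof.
move=> r0; have [a D] := flux_derivable r.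
suff -> : profile r `^ p - (N%:R - 1) / r * flux r = a by [].
have rn0 : r != 0 by rewrite gt_eqF.
have xr : enorm (r *: e) = r by rewrite enorm_re // ltW.
have DW := derM D (derV rn0 (derid r)).
have Dx i : partial i (fun y =>
    ((Num.sqrt (1 - enorm (grad u y) ^+ 2))^-1 *: grad u y) ord0 i) (r *: e) =
    - ((a / r - flux r / r ^+ 2) * ((r *: e) ord0 i ^+ 2 / r) + flux r / r).
  rewrite /partial (near_eq_derive (g := fun y => - (flux (enorm y) / enorm y * y ord0 i))).
    have x0 : 0 < enorm (r *: e) by rewrite xr.
    have DW' : is_derive (enorm (r *: e)) 1 (fun r => flux r * r^-1)
      (a * r^-1 + flux r * (- 1 / r ^+ 2)) by rewrite xr.
    have D1 := is_derive_radial i x0 DW'.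
    have D2 := is_derive_coord (r *: e) i.
    have [_ ->] := is_deriveN (is_deriveM D1 D2).
    rewrite /GRing.scale /= xr; congr (- _).
    by set t := _ ord0 i; field.
  (* The radial formula for the gradient is available only off the origin, and differentiating it
     requires it on a neighbourhood. *)
  have : \forall y \near (r *: e), y != 0.
    have x0 : r *: e != 0 by rewrite -enorm_gt0 xr.
    have o : open (~` [set 0 : 'rV[R]_N]).
      exact/closed_openC/accessible_closed_set1/hausdorff_accessible/norm_hausdorff.
    have : nbhs (r *: e) (~` [set 0 : 'rV[R]_N]).
      by apply: open_nbhs_nbhs; split => //; apply/eqP.
    by apply: filterS => z /eqP.
  by apply: filterS => y y0; rewrite normal_gradE // mulNr.
have := u_eq (r *: e); rewrite /mean_curvature /divergence (eq_bigr _ (fun i _ => Dx i)).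
rewrite sumrN big_split /= -mulr_sumr -mulr_suml -enorm2 xr sumr_const card_ord -/(profile r).
move=> /eqP; rewrite addr_eq0 eqr_oppLR opprK => /eqP <-.
by rewrite -mulr_natr; field.
Qed.

Lemma flux_bounded_near0 : exists C d : R, 0 < d /\ forall r, 0 < r < d -> `|flux r| <= C.
Proof.
have [a D] := flux_derivable 0.
have c0 : {for 0, continuous flux} by exact: (@der_continuous _ flux (fun _ => a)).
have : \forall t \near (0 : R), `|flux t| <= `|flux 0| + 1.
  have h : `|flux 0| < `|flux 0| + 1 by rewrite ltrDl.
  exact: (@cvgr_norm_le _ _ _ (nbhs (0 : R)) _ flux (flux 0) c0 _ h).
move=> [d /= d0 H].
exists (`|flux 0| + 1), d; split => // r /andP[r0 rd].
by apply: H; rewrite /= sub0r normrN gtr0_norm.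
Qed.

(** Radiality makes the profile even, so its derivative at 0 equals its own opposite. *)
Lemma slope0 : slope 0 = 0.
Proof.
have D := profile_der 0.
have D' : is_derive (- 0 : R) 1 profile (- slope 0) by rewrite oppr0.
have := der_comp D' (derN (derid 0)).
rewrite (_ : (fun y : R => profile (- y)) = profile); last first.
  by apply/funext => r; apply: u_radial; rewrite !enormZ normrN.
by case: D => _ E1 [_ ]; rewrite E1; lra.
Qed.

End RadialSolution.

(** * Smooth functions on the line *)

Section SmoothReal.
Context {R : realType}.
Implicit Types (f g : R -> R) (x y : R).

(** Derivatives are carried as witnesses, which makes products and composites inductive. Continuity
    of the last derivative is not included; passing to [Ck k] therefore starts from order k.+1. *)
Fixpoint smooth_upto (k : nat) f : Prop :=
  if k is k'.+1 then
    exists f', (forall x, is_derive x 1 f (f' x)) /\ smooth_upto k' f'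
  else True.

Lemma smooth_uptoW k f : smooth_upto k.+1 f -> smooth_upto k f.
Proof.
elim: k f => [//|k IH] f [f' [D S]].
by exists f'; split => //; exact: IH.
Qed.

Lemma smooth_upto_cst k (c : R) : smooth_upto k (fun _ => c).
Proof.
elim: k c => [//|k IH] c; exists (fun _ => 0); split; last exact: IH.
by move=> x; exact: dercst.
Qed.

Lemma smooth_upto_id k : smooth_upto k (fun x => x).
Proof.
case: k => [//|k]; exists (fun _ => 1); split; last exact: smooth_upto_cst.
by move=> x; exact: derid.
Qed.

Lemma smooth_uptoD k f g :
  smooth_upto k f -> smooth_upto k g -> smooth_upto k (fun x => f x + g x).
Proof.
elim: k f g => [//|k IH] f g [f' [Df Sf]] [g' [Dg Sg]].
exists (fun x => f' x + g' x); split; last exact: IH.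
by move=> x; exact: derD.
Qed.

Lemma smooth_uptoM k f g :
  smooth_upto k f -> smooth_upto k g -> smooth_upto k (fun x => f x * g x).
Proof.
elim: k f g => [//|k IH] f g Sf Sg.
have [[f' [Df Sf']] [g' [Dg Sg']]] := (Sf, Sg).
exists (fun x => f' x * g x + f x * g' x); split.
  by move=> x; exact: derM.
by apply: smooth_uptoD; apply: IH => //; exact: smooth_uptoW.
Qed.

Lemma smooth_upto_affine k f (a b : R) :
  smooth_upto k f -> smooth_upto k (fun x => f (a * x + b)).
Proof.
elim: k f => [//|k IH] f [f' [Df Sf]].
exists (fun x => f' (a * x + b) * a); split.
  move=> x; have DA : is_derive x 1 (fun y : R => a * y + b) a.
    by apply: (is_derive_eq (derD (derZ a (derid x)) (dercst b x))); rewrite addr0 mulr1.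
  exact: (der_comp (Df _) DA).
by apply: smooth_uptoM; [exact: IH|exact: smooth_upto_cst].
Qed.

Lemma smooth_uptoV k f : (forall x, f x != 0) ->
  smooth_upto k f -> smooth_upto k (fun x => (f x)^-1).
Proof.
move=> f0; elim: k => [//|k IH] Sf.
have [f' [Df Sf']] := Sf.
exists (fun x => (-1 * f' x) * ((f x)^-1 * (f x)^-1)); split.
  move=> x; apply: (is_derive_eq (derV (f0 x) (Df x))).
  by field; exact: f0.
apply: smooth_uptoM; first by apply: smooth_uptoM => //; exact: smooth_upto_cst.
by apply: smooth_uptoM; apply: IH; exact: smooth_uptoW.
Qed.

Lemma smooth_upto_sum k (m : nat) (F : nat -> R -> R) :
  (forall i, smooth_upto k (F i)) ->
  smooth_upto k (fun x => \sum_(i < m) F i x).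
Proof.
move=> SF; elim: m => [|m IH].
  have -> : (fun x => \sum_(i < 0) F i x) = (fun _ => 0).
    by apply/funext => x; rewrite big_ord0.
  exact: smooth_upto_cst.
have -> : (fun x => \sum_(i < m.+1) F i x) = (fun x => \sum_(i < m) F i x + F m x).
  by apply/funext => x; rewrite big_ord_recr.
exact: smooth_uptoD.
Qed.

(** * Flat functions and a smooth ramp *)

Lemma der_near_eq f g x (a : R) : (\forall y \near x, f y = g y) ->
  is_derive x 1 g a -> is_derive x 1 f a.
Proof.
move=> fg [D V]; split; last by rewrite (@near_eq_derive _ _ _ f g x 1 fg).
by apply: near_eq_derivable D; apply: filterS fg => y ->.
Qed.

Lemma der_quadratic f (C : R) : (forall x, `|f x| <= C * x ^+ 2) ->
  is_derive (0 : R) 1 f 0.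
Proof.
move=> fC.
have f0 : f 0 = 0 by apply/normr0_eq0/eqP; rewrite eq_le normr_ge0 andbT;
  have := fC 0; rewrite expr0n mulr0.
have L : (fun h : R => h^-1 *: ((f \o shift 0) (h *: (1 : R)) - f 0)) @ 0^' --> (0 : R).
  apply/cvgr0Pnorm_le => eps eps0.
  have C1 : 0 < `|C| + 1 by rewrite ltr_wpDl.
  have : \forall h \near (0 : R)^', `|h| <= eps / (`|C| + 1).
    apply: (@cvgr0_norm_le _ _ _ (0 : R)^' _ id); last by rewrite divr_gt0.
    exact: nbhs_dnbhs.
  apply: filterS => h; rewrite ler_pdivlMr // => hC /=.
  rewrite addr0 f0 subr0 [h *: 1]mulr1 normrM normfV.
  have [->|h0] := eqVneq h 0; first by rewrite normr0 invr0 mul0r ltW.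
  rewrite ler_pdivrMl ?normr_gt0 //; apply: le_trans (fC h) _.
  rewrite -real_normK ?num_real // expr2 mulrCA ler_wpM2l //.
  apply: le_trans hC; rewrite mulrC ler_wpM2l //.
  by have := ler_norm C; lra.
split; first by apply/cvg_ex; exists 0.
by apply/cvg_lim; [exact: norm_hausdorff|exact: L].
Qed.

(** The family P(1/x) exp(-1/x), extended by 0, is closed under differentiation: P becomes X^2 (P -
    P'). With P = 1 it is the classical smooth function that is flat at 0. *)
Definition flat (P : {poly R}) x : R :=
  if 0 < x then P.[x^-1] * expR (- x^-1) else 0.

(** Each monomial obeys y^i <= i! exp(y), a single term of the exponential series. *)
Lemma poly_le_exp (P : {poly R}) : exists C, 0 <= C /\
  forall y, 0 <= y -> `|P.[y]| <= C * expR y.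
Proof.
exists (\sum_(i < size P) `|P`_i| * (i`!)%:R); split.
  by apply: sumr_ge0 => i _; rewrite mulr_ge0.
move=> y y0; rewrite horner_coef mulr_suml.
apply: le_trans (ler_norm_sum _ _ _) _; apply: ler_sum => -[i /= _] _.
rewrite normrM normrX (ger0_norm y0) -mulrA ler_wpM2l //.
case: i => [|i]; first by rewrite expr0 fact0 mul1r; have := expR_ge1Dx y; lra.
have f0 : 0 < (i.+1`!)%:R :> R by rewrite ltr0n fact_gt0.
rewrite mulrC -ler_pdivrMr //.
by have := expR_ge1Dxn i y0; lra.
Qed.

Lemma flat_der (P : {poly R}) x :
  is_derive x 1 (flat P) (flat ('X^2 * (P - P^`())) x).
Proof.
have [x0|x0|<-] := ltgtP 0 x.
- apply: (@der_near_eq _ (fun y => P.[y^-1] * expR (- y^-1))).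
    have : \forall y \near x, 0 < y by exact: lt_nbhsr.
    by apply: filterS => y y0; rewrite /flat y0.
  have xn0 : x != 0 by rewrite gt_eqF.
  have DV := derV xn0 (derid x).
  have DP : is_derive x^-1 1 (horner P) (P^`().[x^-1]) by exact: is_derive_poly.
  have DE := @der_comp R (@expR R) (fun y => - y^-1) x _ _ (is_derive_expR (- x^-1)) (derN DV).
  have D := derM (der_comp DP DV) DE.
  apply: (is_derive_eq D).
  rewrite /flat x0 !hornerE /=.
  by field.
- rewrite {2}/flat ltNge (ltW x0) /=; refine (der_near_eq _ (dercst 0 x)).
    have : \forall y \near x, y < 0 by exact: lt_nbhsl.
    by apply: filterS => y y0; rewrite /flat ltNge (ltW y0).
- rewrite {2}/flat ltxx.
  (* The extra factor X^2 turns the bound into |P(1/y)| exp(-1/y) <= C y^2, and a quadratic bound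
     forces derivative 0 at the origin. *)
  have [C [C0 PC]] := poly_le_exp ('X^2 * P).
  apply: (@der_quadratic _ C) => y; rewrite /flat; case: ifPn => y0; last first.
    by rewrite normr0 mulr_ge0 // sqr_ge0.
  have yV : 0 <= y^-1 by rewrite invr_ge0 ltW.
  rewrite normrM (ger0_norm (expR_ge0 _)) expRN ler_pdivrMr ?expR_gt0 //.
  have := PC _ yV; rewrite hornerM hornerXn normrM (ger0_norm (exprn_ge0 2 yV)) exprVn.
  by rewrite ler_pdivrMl ?exprn_gt0 // mulrCA mulrA.
Qed.

Lemma smooth_upto_flat k (P : {poly R}) : smooth_upto k (flat P).
Proof.
elim: k P => [//|k IH] P; exists (flat ('X^2 * (P - P^`()))).
by split; [exact: flat_der|exact: IH].
Qed.

Let psi x := flat 1 x.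

Let psi_ge0 x : 0 <= psi x.
Proof. by rewrite /psi /flat; case: ifP => // _; rewrite hornerE mul1r expR_ge0. Qed.

Let psi_gt0 x : 0 < x -> 0 < psi x.
Proof. by rewrite /psi /flat => ->; rewrite hornerE mul1r expR_gt0. Qed.

Let psi0 x : x <= 0 -> psi x = 0.
Proof. by rewrite /psi /flat ltNge => ->. Qed.

Let step x := psi (2 * x + - 2^-1) * (psi (2 * x + - 2^-1) + psi (-2 * x + (1 + 2^-1)))^-1.

Let step_den x : 0 < psi (2 * x + - 2^-1) + psi (-2 * x + (1 + 2^-1)).
Proof.
have [h|h] := ltP (2^-1 : R) (2 * x).
  by rewrite ltr_wpDr // psi_gt0 // subr_gt0.
by rewrite ltr_wpDl // psi_gt0 //; lra.
Qed.

(* The step function is locally constant at 0 and 1, hence the affine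
   rescaling by 2. *)
Lemma smooth_ramp : exists S S' : R -> R, exists B : R,
  [/\ forall k, smooth_upto k S, forall x, is_derive x 1 S (S' x),
      forall x, x <= 0 -> S' x = 0, forall x, 1 <= x -> S' x = 1 &
      forall x, `|S' x| <= B].
Proof.
(* Multiplying by x gives explicitly a function whose derivative passes from 0 to 1, instead of
   integrating a step. The derivative need not stay in [0, 1] in between, hence the bound [B]. *)
pose S x := x * step x.
have smS k : smooth_upto k S.
  apply: smooth_uptoM; first exact: smooth_upto_id.
  apply: smooth_uptoM; first by apply: (@smooth_upto_affine _ psi); exact: smooth_upto_flat.
  apply: smooth_uptoV; first by move=> x; rewrite gt_eqF.
  by apply: smooth_uptoD; apply: (@smooth_upto_affine _ psi); exact: smooth_upto_flat.
have [S' [DS [S'' [DS' _]]]] := smS 2%N.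
have S'0 x : x <= 0 -> S' x = 0.
  move=> x0; have [_ <-] := DS x.
  suff [_ ->] : is_derive x 1 S 0 by [].
  refine (der_near_eq _ (dercst 0 x)).
  have : \forall y \near x, y < 4^-1 by apply: lt_nbhsl; apply: le_lt_trans x0 _; rewrite invr_gt0.
  by apply: filterS => y y0; rewrite /S /step psi0 ?mul0r ?mulr0 //; lra.
have S'1 x : 1 <= x -> S' x = 1.
  move=> x1; have [_ <-] := DS x.
  suff [_ ->] : is_derive x 1 S 1 by [].
  refine (der_near_eq _ (derid x)).
  have : \forall y \near x, 3 / 4 < y by apply: lt_nbhsr; lra.
  apply: filterS => y y0; rewrite /S /step (psi0 (x := -2 * y + _)); last lra.
  by rewrite addr0 divff ?mulr1 // gt_eqF // psi_gt0 //; lra.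
have cS' : continuous S' by move=> x; apply: (@der_continuous _ _ S'').
have cW : {within `[0, 1], continuous S'} by exact: continuous_subspaceT.
have [c1 _ M1] := EVT_max (@ler01 R) cW.
have [c2 _ M2] := EVT_min (@ler01 R) cW.
exists S, S', (`|S' c1| + `|S' c2| + 1); split => // x.
have [x0|x0] := leP x 0; first by rewrite S'0 // normr0 !addr_ge0.
have [x1|x1] := leP 1 x; first by rewrite S'1 // normr1 lerDr addr_ge0.
have xi : x \in `[0, 1] by rewrite in_itv /= !ltW.
rewrite ler_norml; apply/andP; split.
  have := M2 _ xi; have := ler_norm (- S' c2); rewrite normrN.
  have := normr_ge0 (S' c1); lra.
have := M1 _ xi; have := ler_norm (S' c1); have := normr_ge0 (S' c2); lra.
Qed.

(** * Approximating continuous functions by derivatives of smooth ones *)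

Lemma uniformly_continuous_itv f (T eta : R) : continuous f -> 0 < eta ->
  exists d : R, 0 < d /\ forall x y, 0 <= x <= T -> `|y - x| <= d -> `|f y - f x| <= eta.
Proof.
move=> cf eta0.
pose P (d x : R) := forall y, `|y - x| <= d -> `|f y - f x| <= eta.
have K := proj1 (compact_near_coveringP _) (@segment_compact _ 0 T) _ ((0 : R)^'+) P _.
have : \forall d \near (0 : R)^'+, `[0, T] `<=` P d.
  apply: K => x _.
  have e2 : 0 < eta / 2 by rewrite divr_gt0.
  have /cvgrPdist_le /(_ _ e2) [r /= r0 xr] := cf x.
  exists (ball x (r / 2), [set d | d < r / 2]) => /=.
    split; first by apply: nbhsx_ballx; rewrite divr_gt0.
    by apply: nbhs_right_lt; rewrite divr_gt0.
  move=> [z d] /= [xz dr] y yz.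
  have hz : `|x - z| < r / 2 by [].
  have fz : `|f x - f z| <= eta / 2 by apply: xr => /=; lra.
  have fy : `|f x - f y| <= eta / 2.
    apply: xr => /=; rewrite (_ : x - y = (x - z) - (y - z)); last ring.
    by apply: le_lt_trans (ler_normB _ _) _; lra.
  rewrite (_ : f y - f z = (f x - f z) - (f x - f y)); last ring.
  by apply: le_trans (ler_normB _ _) _; lra.
move=> [d /= d0 H].
exists (d / 2); split; first by rewrite divr_gt0.
move=> x y x0T; apply: (H (d / 2)) => //=; last by rewrite divr_gt0.
by rewrite sub0r normrN gtr0_norm ?divr_gt0 // ltr_pdivrMr // ltr_pMr // (ltr_nat _ 1 2).
Qed.

(** In place of mollification, f is replaced by a smooth staircase, a sum of increments of f times
    translates of [S']. Its primitive is the corresponding explicit sum of translates of [S], and at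
    each point at most one step is in transition. *)
Lemma smooth_primitive_approx f (T eta : R) : continuous f ->
  0 < T -> (forall s : R, T <= s -> f s = 0) -> 0 < eta ->
  exists g g' : R -> R, [/\ forall k, smooth_upto k g,
    forall s : R, is_derive s 1 g (g' s),
    forall s : R, 0 <= s -> `|g' s - f s| <= eta &
    forall s : R, T <= s -> g s = 0 /\ g' s = 0].
Proof.
move=> cf T0 fT eta0.
have [S [S' [B [smS DS S'0 S'1 S'B]]]] := smooth_ramp.
have B0 : 0 <= B by exact: le_trans (S'B 0).
have eB : 0 < eta / (1 + B) by rewrite divr_gt0 //; lra.
have [d0 [d00 fd]] := uniformly_continuous_itv T cf eB.
pose M := (Num.truncn (T / d0)).+1.
have M0 : 0 < M%:R :> R by rewrite ltr0n.
pose d := T / M%:R.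
have d_gt0 : 0 < d by rewrite divr_gt0.
have dd0 : d <= d0.
  rewrite ler_pdivrMr // mulrC -ler_pdivrMr // ltW //.
  by have /andP[] := truncn_itv (ltW (divr_gt0 T0 d00)).
pose s (i : nat) : R := i%:R * d.
have sM : s M = T by rewrite /s /d mulrC divfK // gt_eqF.
have sS i : s i.+1 = s i + d by rewrite /s -natr1 mulrDl mul1r.
have s_le i j : (i <= j)%N -> s i <= s j by move=> ij; rewrite ler_pM2r // ler_nat.
pose k i := f (s i).
pose h (m : nat) (t : R) := k 0%N + \sum_(i < m) (k i.+1 - k i) * S' (d^-1 * t + - (s i / d)).
pose H (m : nat) (t : R) := k 0%N * t + \sum_(i < m) ((k i.+1 - k i) * d) * S (d^-1 * t + - (s i / d)).
have hS m t : h m.+1 t = h m t + (k m.+1 - k m) * S' (d^-1 * t + - (s m / d)).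
  by rewrite /h big_ord_recr addrA.
have HS m t : H m.+1 t = H m t + ((k m.+1 - k m) * d) * S (d^-1 * t + - (s m / d)).
  by rewrite /H big_ord_recr addrA.
have DH m (t : R) : is_derive t 1 (H m) (h m t).
  elim: m => [|m IH].
    have -> : H 0%N = (fun t => k 0%N * t) by apply/funext => z; rewrite /H big_ord0 addr0.
    by rewrite /h big_ord0 addr0; apply: (is_derive_eq (derZ _ (derid t))); rewrite mulr1.
  have -> : H m.+1 = (fun t => H m t + ((k m.+1 - k m) * d) * S (d^-1 * t + - (s m / d))).
    by apply/funext => z; exact: HS.
  rewrite hS; apply: derD => //.
  have DA : is_derive t 1 (fun t => d^-1 * t + - (s m / d)) d^-1.
    by apply: (is_derive_eq (derD (derZ d^-1 (derid t)) (dercst (- (s m / d)) t))); rewrite addr0 mulr1.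
  apply: (is_derive_eq (derZ ((k m.+1 - k m) * d) (der_comp (DS _) DA))).
  by field; rewrite gt_eqF.
have argE t i : d^-1 * t + - (s i / d) = (t - s i) / d by rewrite mulrC mulrBl.
have arg0 t i : t <= s i -> S' (d^-1 * t + - (s i / d)) = 0.
  by move=> ti; rewrite S'0 // argE pmulr_lle0 ?invr_gt0 // subr_le0.
have arg1 t i : s i.+1 <= t -> S' (d^-1 * t + - (s i / d)) = 1.
  by move=> ti; rewrite S'1 // argE ler_pdivlMr // mul1r; move: ti; rewrite sS; lra.
have h_right m t : s m <= t -> h m t = k m.
  elim: m => [|m IH] mt; first by rewrite /h big_ord0 addr0.
  by rewrite hS arg1 // IH ?mulr1; [ring|exact: le_trans (s_le _ _ (leqnSn m)) mt].
have h_left m n t : (m <= n)%N -> t <= s m -> h n t = h m t.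
  move=> mn tm; rewrite -(subnKC mn); elim: (n - m)%N => [|j IH]; first by rewrite addn0.
  rewrite addnS hS arg0 ?mulr0 ?addr0 //.
  by apply: le_trans tm _; apply: s_le; exact: leq_addr.
have hM t : T <= t -> h M t = 0 by move=> Tt; rewrite h_right ?sM // /k sM fT.
(* The staircase vanishes beyond T because f(T) = 0, so its primitive is constant there; subtracting
   [H M T] makes that constant 0. *)
exists (fun t => H M t + - H M T), (h M); split.
- move=> j; apply: smooth_uptoD; last exact: smooth_upto_cst.
  apply: smooth_uptoD.
    by apply: smooth_uptoM; [exact: smooth_upto_cst|exact: smooth_upto_id].
  apply: (@smooth_upto_sum j M (fun i t => (k i.+1 - k i) * d * S (d^-1 * t + - (s i / d)))).
  move=> i; apply: smooth_uptoM; first exact: smooth_upto_cst.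
  exact: (@smooth_upto_affine _ S).
- move=> t; apply: (is_derive_eq (derB (DH M t) (dercst (H M T) t))).
  by rewrite subr0.
- move=> t t0; have [tT|Tt] := ltP t T; last first.
    by rewrite hM // fT // subr0 normr0 ltW.
  pose j := Num.truncn (t / d).
  have /andP[] := truncn_itv (divr_ge0 t0 (ltW d_gt0)); rewrite -/j.
  rewrite ler_pdivlMr // ltr_pdivrMr // -/(s j) -/(s j.+1) => jt tj.
  have jM : (j.+1 <= M)%N.
    have : s j < s M by rewrite sM; exact: le_lt_trans jt tT.
    by rewrite ltr_pM2r // ltr_nat.
  (* Between two nodes the staircase is k_j + (k_(j+1) - k_j) S', which differs from f by at most (1
     + B) oscillations, hence eta / (1 + B). *)
  rewrite (h_left j.+1) ?(ltW tj) // hS h_right //.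
  have tI : 0 <= t <= T by rewrite t0 ltW.
  have E1 : `|k j - f t| <= eta / (1 + B).
    by apply: fd => //; rewrite ler_norml; move: tj; rewrite sS; lra.
  have E2 : `|k j.+1 - k j| <= eta / (1 + B).
    apply: fd; last by rewrite sS addrC addKr gtr0_norm.
    by rewrite mulr_ge0 ?(ltW d_gt0) //= (le_trans jt) // ltW.
  rewrite addrAC; apply: le_trans (ler_normD _ _) _.
  rewrite (_ : eta = eta / (1 + B) + eta / (1 + B) * B); last by field; lra.
  by rewrite lerD // normrM ler_pM.
- move=> t Tt; split; last exact: hM.
  apply/eqP; rewrite subr_eq0 eq_le; apply/andP; split.
    apply: (@der_le0_le _ (H M) (h M)) => // z /andP[Tz _]; by rewrite hM.
  apply: (@der_ge0_le _ (H M) (h M)) => // z /andP[Tz _]; by rewrite hM.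
Qed.

End SmoothReal.

(** * Integrals over R^n *)

Section MonotoneIntegral.
Context {d : measure_display} {T : measurableType d} {R : realType}.
Variable mu : {measure set T -> \bar R}.

(** The integral of a nonnegative function is a supremum over the simple functions below it, hence
    monotone for arbitrary functions. The norm estimates below use it in this generality. *)
Lemma ge0_le_integralT (f g : T -> \bar R) : (forall x, (0 <= f x)%E) ->
  (forall x, (f x <= g x)%E) -> (\int[mu]_x f x <= \int[mu]_x g x)%E.
Proof.
move=> f0 fg; have g0 x : (0 <= g x)%E by exact: le_trans (fg x).
rewrite !ge0_integralTE //; apply: le_ereal_sup => _ [h /= hf <-].
by exists h => // x; exact: le_trans (fg x).
Qed.

End MonotoneIntegral.

(** * One-variable weights and integrals of their products *)

Section Integral1D.
Context {R : realType}.
Variable c : R.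
Hypothesis c_gt1 : 1 < c.

Let wt (t : R) : R := (1 + `|t|) `^ (- c).

Let one_norm_gt0 (t : R) : 0 < 1 + `|t|.
Proof. by rewrite ltr_wpDr. Qed.

Let wt_ge0 t : 0 <= wt t. Proof. exact: powR_ge0. Qed.

Let wt_continuous : continuous wt.
Proof.
move=> t; apply: (@continuous_comp R R R (fun t : R => 1 + `|t|) (fun y : R => y `^ (- c))).
  apply: cvgD; first exact: cvg_cst.
  by apply: cvg_norm; exact: cvg_id.
apply: (@der_continuous _ _ (fun y => - c * y `^ (- c - 1))).
exact: is_derive1_powR.
Qed.

Lemma integral_wt : (\int[lebesgue_measure]_t (wt t)%:E = (2 / (c - 1))%:E)%E.
Proof.
have c1 := c_gt1.
rewrite ge0_symfun_integralT //; last by move=> t /=; rewrite /wt normrN.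
rewrite (_ : [set x | (0 <= x)] = `[0, +oo[%classic); last first.
  by apply/seteqP; split => x /=; rewrite in_itv /= andbT.
pose F (x : R) := (1 - c)^-1 * (1 + x) `^ (1 - c).
have DF (x : R) : 0 <= x -> is_derive x 1 F ((1 + x) `^ (- c)).
  move=> x0; have p0 : 0 < 1 + x by lra.
  apply: (is_derive_eq (derZ _ (derpow (f := fun x => 1 + x) (1 - c) p0 (derD (dercst 1 x) (derid x))))).
  by rewrite (_ : 1 - c - 1 = - c); [field; lra|ring].
rewrite (@ge0_continuous_FTC2y _ wt F 0 0) //.
- by rewrite /F addr0 powR1 mulr1 sub0e -EFinN -EFinM; congr EFin; field; lra.
- exact: continuous_subspaceT.
- have k0 : 0 < c - 1 by lra.
  apply/cvgr0Pnorm_le => eps eps0.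
  have e0 : 0 < (eps * (c - 1)) by rewrite mulr_gt0.
  near=> x.
  have x0 : 0 <= x by near: x; exact: nbhs_pinfty_ge.
  have xM : (eps * (c - 1)) `^ (- (c - 1)^-1) <= x by near: x; exact: nbhs_pinfty_ge.
  rewrite /F normrM (ger0_norm (powR_ge0 _ _)) normfV ltr0_norm; last lra.
  rewrite opprB mulrC ler_pdivrMr //.
  rewrite (_ : eps * (c - 1) = ((eps * (c - 1)) `^ (- (c - 1)^-1)) `^ (- (c - 1))); last first.
    by rewrite -powRrM mulrNN mulVf ?gt_eqF // powRr1 // ltW.
  rewrite -opprB; apply: powR_opp_le; [exact: ltW|by rewrite powR_gt0|lra].
- by move=> x x0; have [] := DF _ (ltW x0).
- have C0 : {for 0, continuous F} by apply: (@der_continuous _ F (fun x => (1 + x) `^ (- c))); exact: DF.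
  by apply: cvg_at_right_filter; exact: C0.
- move=> x; rewrite in_itv /= andbT => x0.
  by rewrite derive1E /wt gtr0_norm //; have [_] := DF _ (ltW x0).
Unshelve. all: by end_near. Qed.

Lemma measurable_wt : measurable_fun setT wt.
Proof. exact: continuous_measurable_fun. Qed.

Definition wtprod (n : nat) (x : 'rV[R]_n) : R := \prod_(i < n) wt (x ord0 i).

Lemma wtprod_ge0 n (x : 'rV[R]_n) : 0 <= wtprod x.
Proof. by apply: prodr_ge0. Qed.

Lemma measurable_wtprod n : measurable_fun setT (@wtprod n).
Proof.
apply: (@measurable_prod _ _ _ _ _ _ (fun i (x : 'rV[R]_n) => wt (x ord0 i))) => i _.
by apply: measurableT_comp; [exact: measurable_wt|exact: measurable_coord].
Qed.

Lemma measurable_EFin_wtprod n : measurable_fun setT (fun x => (@wtprod n x)%:E).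
Proof. by apply/measurable_EFinP; exact: measurable_wtprod. Qed.

(** The measure on R^(n+1) is the image of a product measure under [rV_cons], so Tonelli splits off
    the first coordinate. *)
Lemma integral_wtprod n :
  (\int[lebesgue_rV R n]_x (wtprod x)%:E = ((2 / (c - 1)) ^+ n)%:E)%E.
Proof.
elim: n => [|n IH].
  rewrite /= integral_dirac //; last exact: measurable_EFin_wtprod.
  by rewrite diracE mem_set // mul1e /wtprod big_ord0.
transitivity (\int[pushforward (lebesgue_measure \x lebesgue_rV R n) (@rV_cons R n)]_x (wtprod x)%:E)%E.
  exact: eq_measure_integral.
rewrite ge0_integral_pushforward //; first last.
- by move=> x _; rewrite lee_fin wtprod_ge0.
- exact: measurable_EFin_wtprod.
rewrite preimage_setT fubini_tonelli1; first last.
- by move=> x; rewrite lee_fin wtprod_ge0.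
- apply/measurable_EFinP; apply: measurableT_comp; first exact: measurable_wtprod.
  exact: measurable_rV_cons.
have E a v : (wtprod (rV_cons (a, v)))%:E = ((wt a)%:E * (wtprod v)%:E)%E.
  rewrite -EFinM /wtprod big_ord_recl mxE unlift_none /=; congr (_ * _)%:E.
  by apply: eq_bigr => i _; rewrite mxE liftK.
transitivity (\int[lebesgue_measure]_a ((wt a)%:E * ((2 / (c - 1)) ^+ n)%:E))%E.
  apply: eq_integral => a _; rewrite /fubini_F /=.
  rewrite (eq_integral (fun v => (wt a)%:E * (wtprod v)%:E)%E); last by move=> v _; exact: E.
  rewrite ge0_integralZl ?IH ?lee_fin //.
  - exact: measurable_EFin_wtprod.
  - by move=> x _; rewrite lee_fin wtprod_ge0.
rewrite ge0_integralZr ?integral_wt //.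
- by rewrite -EFinM exprS.
- by apply/measurable_EFinP; exact: measurable_wt.
- by move=> x _; rewrite lee_fin.
- by rewrite lee_fin exprn_ge0 // divr_ge0 //; have := c_gt1; lra.
Qed.

End Integral1D.

Section LebesgueNorms.
Context {R : realType} {n : nat}.
Implicit Types (f : 'rV[R]_n -> R) (x : 'rV[R]_n).

(** Multiply the n inequalities (1 + |x_i|)^2 <= 2 (1 + |x|^2). A radial weight is thus integrated
    without polar coordinates. *)
Lemma decay_le_wtprod c x : 0 < c ->
  (1 + enorm x ^+ 2) `^ (- (c * n%:R / 2)) <= 2 `^ (c * n%:R / 2) * wtprod c x.
Proof.
move=> c0.
have X0 : 0 < 1 + enorm x ^+ 2 by rewrite ltr_pwDl // sqr_ge0.
have W i : (2 * (1 + enorm x ^+ 2)) `^ (- (c / 2)) <= (1 + `|x ord0 i|) `^ (- c).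
  rewrite (_ : (1 + `|x ord0 i|) `^ (- c) = ((1 + `|x ord0 i|) ^+ 2) `^ (- (c / 2))); last first.
    rewrite -powR_mulrn ?addr_ge0 // -powRrM; congr (_ `^ _); by field.
  apply: powR_opp_le; first by rewrite divr_ge0 // ltW.
    by rewrite exprn_gt0 // ltr_pwDl.
  have : `|x ord0 i| ^+ 2 <= enorm x ^+ 2.
    by rewrite ler_sqr ?nnegrE ?enorm_ge0 // coord_le_enorm.
  by have := sqr_ge0 (1 - `|x ord0 i|); rewrite !expr2; nra.
have : \prod_(i < n) (2 * (1 + enorm x ^+ 2)) `^ (- (c / 2)) <= wtprod c x.
  by apply: ler_prod => i _; rewrite powR_ge0 W.
rewrite prodr_const card_ord -powR_mulrn ?powR_ge0 // -powRrM.
have -> : - (c / 2) * n%:R = - (c * n%:R / 2) by field.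
rewrite powRM ?(ltW X0) // => H.
rewrite -ler_pdivrMl ?powR_gt0 // -powRN.
exact: H.
Qed.

Lemma integral_decay b : (0 < n)%N -> n%:R / 2 < b -> exists I, 0 <= I /\
  forall A, 0 <= A ->
  (\int[lebesgue_rV R n]_x (A * (1 + enorm x ^+ 2) `^ (- b))%:E <= (A * I)%:E)%E.
Proof.
move=> n0 nb; have nR : 0 < n%:R :> R by rewrite ltr0n.
pose c := 2 * b / n%:R.
have c1 : 1 < c by rewrite /c ltr_pdivlMr //; lra.
have bE : b = c * n%:R / 2 by rewrite /c; field; rewrite gt_eqF.
exists (2 `^ b * (2 / (c - 1)) ^+ n); split.
  by rewrite mulr_ge0 ?powR_ge0 // exprn_ge0 // divr_ge0 //; lra.
move=> A A0.
apply: (@le_trans _ _ (\int[lebesgue_rV R n]_x ((A * 2 `^ b)%:E * (wtprod c x)%:E))%E).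
  apply: ge0_le_integralT => x; first by rewrite lee_fin mulr_ge0 // powR_ge0.
  rewrite -EFinM lee_fin -mulrA ler_wpM2l // {2}bE {1}bE.
  by apply: decay_le_wtprod; lra.
rewrite ge0_integralZl //.
- by rewrite integral_wtprod // -EFinM mulrA.
- exact: measurable_EFin_wtprod.
- by move=> x _; rewrite lee_fin wtprod_ge0.
- by rewrite lee_fin mulr_ge0 // powR_ge0.
Qed.

Lemma LnormE f q : ('N[lebesgue_rV R n]_q%:E[EFin \o f] =
  (\int[lebesgue_rV R n]_x (`|f x| `^ q)%:E) `^ q^-1)%E.
Proof. by rewrite unlock. Qed.

(** The constant depends on the weight and q but not on f, so smallness in a weighted sup norm
    becomes smallness in L^q. *)
Lemma Lnorm_decay q k : (0 < n)%N -> 0 < q -> n%:R / 2 < k * q -> exists C, 0 <= C /\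
  forall f e, 0 <= e -> (forall x, `|f x| <= e * (1 + enorm x ^+ 2) `^ (- k)) ->
  ('N[lebesgue_rV R n]_q%:E[EFin \o f] <= (C * e)%:E)%E.
Proof.
move=> n0 q0 kq; have [I [I0 HI]] := integral_decay n0 kq.
exists (I `^ q^-1); split; first exact: powR_ge0.
move=> f e e0 fe; rewrite LnormE.
have le1 : (\int[lebesgue_rV R n]_x (`|f x| `^ q)%:E <= (e `^ q * I)%:E)%E.
  apply: le_trans (HI _ (powR_ge0 e q)).
  apply: ge0_le_integralT => x; first by rewrite lee_fin powR_ge0.
  rewrite lee_fin; apply: (@le_trans _ _ ((e * (1 + enorm x ^+ 2) `^ (- k)) `^ q)).
    by apply: powR_le => //; exact: ltW.
  by rewrite powRM ?powR_ge0 // -powRrM mulNr.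
have i0 : (0 <= \int[lebesgue_rV R n]_x (`|f x| `^ q)%:E)%E.
  by apply: integral_ge0 => x _; rewrite lee_fin powR_ge0.
apply: (@le_trans _ _ ((e `^ q * I)%:E `^ q^-1)%E).
  apply: gt0_ler_poweR => //; rewrite ?in_itv /= ?leey ?andbT //.
    by rewrite invr_ge0 ltW.
  by rewrite lee_fin mulr_ge0 // powR_ge0.
rewrite poweR_EFin lee_fin powRM ?powR_ge0 // -powRrM mulfV ?gt_eqF // powRr1 //.
by rewrite mulrC.
Qed.

(** Chebyshev's inequality on the cube [rho, 2 rho]^n, of volume rho^n. *)
Lemma Lnorm_box f q rho m L : 0 < q -> 0 < rho -> 0 <= m -> 0 <= L ->
  (forall x, (forall i, rho <= x ord0 i <= 2 * rho) -> m <= `|f x|) ->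
  ('N[lebesgue_rV R n]_q%:E[EFin \o f] <= L%:E)%E ->
  m `^ q * rho ^+ n <= L `^ q.
Proof.
move=> q0 rho0 m0 L0 fm; rewrite LnormE => NL.
pose B := [set x : 'rV[R]_n | forall i, `[rho, 2 * rho]%classic (x ord0 i)].
have mB : measurable B.
  rewrite (_ : B = \big[setI/setT]_(i < n) ((fun x : 'rV[R]_n => x ord0 i) @^-1` `[rho, 2 * rho])).
    apply: bigsetI_measurable => i _; rewrite -[X in measurable X]setTI.
    by apply: (measurable_coord i) => //; exact: measurable_itv.
  rewrite predeqE => x; split=> [Bx|].
    by rewrite -bigcap_seq => i _; exact: Bx.
  by rewrite -bigcap_seq => + i; apply; rewrite /= mem_index_enum.
have muB : lebesgue_rV R n B = (rho ^+ n)%:E.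
  rewrite /B (@lebesgue_rV_box R n (fun _ => `[rho, 2 * rho]%classic)) //.
  rewrite (eq_bigr (fun _ => rho%:E)); last first.
    move=> i _; rewrite lebesgue_measure_itv /= lte_fin ltr_pMl // (ltr_nat _ 1 2) /=.
    by rewrite -EFinB; congr EFin; ring.
  by rewrite prodEFin prodr_const card_ord.
have i0 : (0 <= \int[lebesgue_rV R n]_x (`|f x| `^ q)%:E)%E.
  by apply: integral_ge0 => x _; rewrite lee_fin powR_ge0.
have le1 : ((m `^ q * rho ^+ n)%:E <= \int[lebesgue_rV R n]_x (`|f x| `^ q)%:E)%E.
  rewrite EFinM -muB -[B in lebesgue_rV R n B]setIT -integral_indic //.
  rewrite -ge0_integralZl ?lee_fin ?powR_ge0 //; last first.
    by apply/measurable_EFinP; exact: measurable_indic.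
  apply: ge0_le_integralT => x; rewrite -EFinM lee_fin ?mulr_ge0 ?powR_ge0 //.
  rewrite indicE; have [xB|xB] := boolP (x \in B); last by rewrite mulr0 powR_ge0.
  rewrite mulr1; apply: powR_le => //; first exact: ltW.
  by apply: fm => i; have := set_mem xB i; rewrite /= in_itv.
rewrite -lee_fin; apply: (le_trans le1).
have -> : (\int[lebesgue_rV R n]_x (`|f x| `^ q)%:E =
   ((\int[lebesgue_rV R n]_x (`|f x| `^ q)%:E) `^ q^-1) `^ q)%E.
  by rewrite -poweRrM mulVf ?gt_eqF // poweRe1.
rewrite -poweR_EFin; apply: gt0_ler_poweR => //; rewrite ?in_itv /= ?leey ?andbT ?poweR_ge0 ?lee_fin //.
exact: ltW.
Qed.

End LebesgueNorms.

(** * Radial functions and D^{1,2} *)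

Section RadialTestFunctions.
Context {R : realType} {n : nat}.
Implicit Types (u f h : 'rV[R]_n -> R) (g : R -> R) (x y : 'rV[R]_n).

Let d (i : 'I_n) : 'rV[R]_n := delta_mx ord0 i.

Lemma CkW k f : Ck k.+1 f -> Ck k f.
Proof.
elim: k f => [|k IH] f [cf Df]; first by [].
by split => // i; have [D S] := Df i; split => //; exact: IH.
Qed.

Lemma Ck_cst k (c : R) : Ck k (fun _ : 'rV[R]_n => c).
Proof.
have cc (b : R) : continuous (fun _ : 'rV[R]_n => b) by move=> x; exact: cst_continuous.
elim: k c => [|k IH] c /=; first exact: cc.
split; [exact: cc|move=> i; split; first by move=> x; exact: derivable_cst].
rewrite (_ : partial i _ = fun _ => 0); first exact: IH.
by apply/funext => x; rewrite /partial derive_cst.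
Qed.

Lemma CkD k f h : Ck k f -> Ck k h -> Ck k (fun x => f x + h x).
Proof.
elim: k f h => [|k IH] f h /=; first by move=> cf ch x; exact: (continuousD (cf x) (ch x)).
move=> [cf Df] [ch Dh]; split; first by move=> x; exact: (continuousD (cf x) (ch x)).
move=> i; have [[df Sf] [dh Sh]] := (Df i, Dh i); split.
  by move=> x; apply: derivableD; [exact: df|exact: dh].
rewrite (_ : partial i _ = fun x => partial i f x + partial i h x); first exact: IH.
by apply/funext => x; rewrite /partial deriveD.
Qed.

Lemma CkM k f h : Ck k f -> Ck k h -> Ck k (fun x => f x * h x).
Proof.
elim: k f h => [|k IH] f h; first by move=> cf ch x; exact: (continuousM (cf x) (ch x)).
move=> Cf Ch; have [[cf Df] [ch Dh]] := (Cf, Ch).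
split; first by move=> x; exact: (continuousM (cf x) (ch x)).
move=> i; have [[df Sf] [dh Sh]] := (Df i, Dh i); split.
  by move=> x; apply: derivableM; [exact: df|exact: dh].
rewrite (_ : partial i _ = fun x => f x * partial i h x + h x * partial i f x).
  by apply: CkD; apply: IH => //; exact: CkW.
by apply/funext => x; rewrite /partial deriveM.
Qed.

Lemma Ck_coord k (i : 'I_n) : Ck k (fun x : 'rV[R]_n => x ord0 i).
Proof.
have cc : continuous (fun x : 'rV[R]_n => x ord0 i) by exact: coord_continuous.
case: k => [|k] //=; split => // j.
have D x : is_derive x (d j) (fun x : 'rV[R]_n => x ord0 i) ((j == i)%:R).
  apply/is_derive_lineP.
  rewrite (_ : (fun s => _) = (fun s => (j == i)%:R * s + x ord0 i)).
    apply: (is_derive_eq (derD (derZ _ (derid 0)) (dercst (x ord0 i) 0))).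
    by rewrite mulr1 addr0.
  by apply/funext => s; rewrite !mxE eqxx /= eq_sym mulrC.
split; first by move=> x; have [] := D x.
rewrite (_ : partial j _ = fun _ => (j == i)%:R); first exact: Ck_cst.
by apply/funext => x; have [_] := D x.
Qed.

Lemma is_derive_sqnorm g x i (a : R) : is_derive (enorm x ^+ 2) 1 g a ->
  is_derive x (d i) (fun y => g (enorm y ^+ 2)) (2 * x ord0 i * a).
Proof.
move=> Dg; apply/is_derive_lineP.
rewrite (funext (fun s : R => congr1 g (enorm2_line x i s))).
pose q (s : R) := enorm x ^+ 2 + (2 * x ord0 i * s + s * s).
have D : is_derive (0 : R) 1 q (0 + (2 * x ord0 i * 1 + (1 * 0 + 0 * 1))).
  exact: derD (dercst _ 0) (derD (derZ _ (derid 0)) (derM (derid 0) (derid 0))).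
have q0 : q 0 = enorm x ^+ 2 by rewrite /q; ring.
have Dg' : is_derive (q 0) 1 g a by rewrite q0.
by apply: (is_derive_eq (der_comp Dg' D)); ring.
Qed.

Lemma sqnorm_continuous : continuous (fun x : 'rV[R]_n => enorm x ^+ 2).
Proof.
rewrite (_ : (fun x => _) = (fun x : 'rV[R]_n => \sum_(i < n) x ord0 i ^+ 2)); last first.
  by apply/funext => x; exact: enorm2.
elim: (index_enum _) => [|i s IH] x.
  rewrite (_ : (fun x => _) = (fun=> 0)); first exact: cst_continuous.
  by apply/funext => y; rewrite big_nil.
rewrite (_ : (fun x => _) = (fun x : 'rV[R]_n => x ord0 i * x ord0 i + \sum_(j <- s) x ord0 j ^+ 2)).
  have C := @coord_continuous _ _ _ ord0 i x.
  exact: (continuousD (continuousM C C) (IH x)).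
by apply/funext => y; rewrite big_cons expr2.
Qed.

(** The i-th partial derivative is 2 x_i g'(|x|^2), again a radial function of the same kind times a
    coordinate, so the induction closes and the origin is not exceptional. *)
Lemma Ck_radial k g : smooth_upto k.+1 g -> Ck k (fun x => g (enorm x ^+ 2)).
Proof.
have cg (h' h : R -> R) : (forall s : R, is_derive s 1 h (h' s)) ->
    continuous (fun x : 'rV[R]_n => h (enorm x ^+ 2)).
  move=> Dh x; apply: (@continuous_comp _ _ _ (fun x : 'rV[R]_n => enorm x ^+ 2) h).
    exact: sqnorm_continuous.
  exact: (@der_continuous _ h h').
elim: k g => [|k IH] g; first by move=> [g' [Dg _]]; exact: (cg g').
move=> [g' [Dg Sg]]; split; first exact: (cg g').
move=> i; have D x := is_derive_sqnorm i (Dg (enorm x ^+ 2)).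
split; first by move=> x; have [] := D x.
rewrite (_ : partial i _ = fun x => (2 * x ord0 i) * g' (enorm x ^+ 2)).
  apply: CkM; last exact: IH.
  by apply: CkM; [exact: Ck_cst|exact: Ck_coord].
by apply/funext => x; have [_] := D x.
Qed.

Lemma test_function_radial g T : (forall k, smooth_upto k g) ->
  (forall s, T <= s -> g s = 0) -> test_function (fun x => g (enorm x ^+ 2)).
Proof.
move=> sg gT; split; first by move=> k; exact: Ck_radial.
pose M := `|T| + 1.
have K : compact [set x : 'rV[R]_n | forall i, `[- M, M]%classic (x ord0 i)].
  by apply: (@rV_compact _ n (fun _ => `[- M, M]%classic)) => i; exact: segment_compact.
apply: (subclosed_compact _ K); first exact: closed_closure.
have Kc := compact_closed (@norm_hausdorff _ _) K.
rewrite ((closure_id _).1 Kc).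
apply: closure_subset => x /= gx i.
have xT : enorm x ^+ 2 < T by rewrite ltNge; apply: contra_neqN gx => /gT.
rewrite in_itv /= -ler_norml; apply: le_trans (coord_le_enorm x i) _.
rewrite -(@ler_sqr R) ?nnegrE ?enorm_ge0 ?addr_ge0 //.
have := ler_norm T; have := normr_ge0 T; rewrite /M !expr2 in xT *; nra.
Qed.

Lemma enorm_grad_radial g g' x : (forall s : R, is_derive s 1 g (g' s)) ->
  enorm (grad (fun y => g (enorm y ^+ 2)) x) = 2 * `|g' (enorm x ^+ 2)| * enorm x.
Proof.
move=> Dg; rewrite (_ : grad _ x = (2 * g' (enorm x ^+ 2)) *: x).
  by rewrite enormZ normrM ger0_norm.
apply/rowP => i; rewrite !mxE /partial.
have [_ ->] := is_derive_sqnorm i (Dg (enorm x ^+ 2)).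
by rewrite mulrAC.
Qed.

(** The gradient error is at most of order e (1+s)^(1/2 - K), in L^2 when 2 (K - 1/2) > n/2; the
    error of the function is of order e (1+s)^(1 - K), in L^{2*} when (K - 1) 2n/(n-2) > n/2. Both
    conditions are n + 2 < 4 K. *)
Lemma D12_radial u (f f' : R -> R) (K : R) : (2 < n)%N -> n%:R + 2 < 4 * K ->
  (forall x, u x = f (enorm x ^+ 2)) ->
  (forall e : R, 0 < e -> exists g : R -> R, exists g' : R -> R, exists T : R,
    [/\ forall k, smooth_upto k g, forall s : R, is_derive s 1 g (g' s),
      forall s : R, T <= s -> g s = 0 & forall s : R, 0 <= s ->
      `|g' s - f' s| <= e * (1 + s) `^ (- K) /\ `|g s - f s| <= e * (1 + s) `^ (1 - K)]) ->
  D12 u.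
Proof.
move=> n2 nK uf approx.
have nR : 2 < n%:R :> R by rewrite (ltr_nat _ 2).
have n0 : (0 < n)%N by exact: ltn_trans n2.
pose ej (j : nat) : R := j.+1%:R^-1.
have ej0 j : 0 < ej j by rewrite invr_gt0 ltr0n.
have ej_cvg0 : ej @ \oo --> (0 : R) by exact: cvg_harmonic.
have [g gP] := choice (fun j => approx _ (ej0 j)).
have [g' gP'] := choice gP; have {gP gP'}[T gP] := choice gP'.
have q2 : n%:R / 2 < (K - 2^-1) * 2 by lra.
have [C1 [C10 HC1]] := Lnorm_decay n0 (ltr0Sn _ 1) q2.
have crit0 : 0 < crit_exp R n by rewrite /crit_exp divr_gt0 ?mulr_gt0 //; lra.
have qc : n%:R / 2 < (K - 1) * crit_exp R n.
  rewrite /crit_exp (_ : (K - 1) * (2 * n%:R / (n%:R - 2)) = n%:R / 2 * (4 * (K - 1) / (n%:R - 2))).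
    rewrite ltr_pMr; last lra.
    by rewrite ltr_pdivlMr; lra.
  by field; lra.
have [C2 [C20 HC2]] := Lnorm_decay n0 crit0 qc.
exists (fun j x => g j (enorm x ^+ 2)); split.
- by move=> j; have [sg _ gT _] := gP j; exact: test_function_radial gT.
- move=> e e0.
  have le1 i j : (gradL2 ((fun x => g i (enorm x ^+ 2)) \- (fun x => g j (enorm x ^+ 2)))%R
      <= (C1 * (2 * (ej i + ej j)))%:E)%E.
    have [_ Di _ Bi] := gP i; have [_ Dj _ Bj] := gP j.
    apply: HC1; first by rewrite mulr_ge0 // addr_ge0 // ltW.
    move=> x; rewrite /=.
    have Dij (s : R) : is_derive s 1 (fun s => g i s - g j s) (g' i s - g' j s).
      exact: (derB (Di s) (Dj s)).
    rewrite (enorm_grad_radial x Dij).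
    set s := enorm x ^+ 2; have s0 : 0 <= s by exact: sqr_ge0.
    have s1 : 0 < 1 + s by lra.
    rewrite !normrM normr_id ger0_norm // (ger0_norm (enorm_ge0 x)) -!mulrA ler_wpM2l //.
    have [b1 _] := Bi s s0; have [b2 _] := Bj s s0.
    have b3 : `|g' i s - g' j s| <= (ej i + ej j) * (1 + s) `^ (- K).
      rewrite (_ : g' i s - g' j s = (g' i s - f' s) - (g' j s - f' s)); last ring.
      by apply: le_trans (ler_normB _ _) _; rewrite mulrDl lerD.
    have b4 : enorm x <= (1 + s) `^ (2^-1).
      rewrite powR12_sqrt ?(ltW s1) // -[leLHS](ger0_norm (enorm_ge0 x)) -sqrtr_sqr.
      by rewrite ler_wsqrtr // -/s lerDr.
    have -> : - (K - 2^-1) = - K + 2^-1 by ring.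
    rewrite powR_addp // mulrA; apply: ler_pM => //.
    exact: enorm_ge0.
  have e4 : 0 < e / (4 * (C1 + 1)) by rewrite divr_gt0 ?mulr_gt0 //; lra.
  have : \forall j \near \oo, `|ej j| < e / (4 * (C1 + 1)).
    by apply: (@cvgr0_norm_lt _ _ _ _ _ _ ej_cvg0).
  move=> H; pose S := [set j : nat | `|ej j| < e / (4 * (C1 + 1))].
  exists (S, S); first by split; exact: H.
  move=> [i j] /= [hi hj]; apply: le_lt_trans (le1 i j) _; rewrite lte_fin.
  move: hi hj; rewrite /S /= !gtr0_norm // !ltr_pdivlMr ?mulr_gt0 //; try lra.
  have := ej0 i; have := ej0 j; move: (ej i) (ej j) => a b a0 b0 ha hb; nra.
- apply: (@squeeze_cvge _ _ _ _ (fun=> 0%E) _ (fun j => (C2 * ej j)%:E)).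
  + near=> j; rewrite Lnorm_ge0 /=.
    have [_ _ _ Bj] := gP j.
    apply: HC2; first exact: ltW.
    move=> x /=; rewrite uf; have [_] := Bj (enorm x ^+ 2) (sqr_ge0 _).
    by rewrite opprB.
  + exact: cvg_cst.
  + apply/cvg_EFin; first by near=> j.
    rewrite -(mulr0 C2); apply: cvgM; first exact: cvg_cst.
    exact: ej_cvg0.
Unshelve. all: by end_near. Qed.

(* A test function vanishes on the cube [rho, 2 rho]^n for large rho, so its
   L^{2^*} distance to u bounds u there. *)
Lemma D12_radial_decay u (U : R -> R) : (2 < n)%N -> D12 u ->
  (forall x, u x = U (enorm x)) ->
  (forall r, 0 < r -> 0 < U r) -> (forall s t, 0 < s -> s <= t -> U t <= U s) ->
  exists C r0, [/\ 0 < C, 1 <= r0 & forall r, r0 <= r -> U r <= C * r `^ (- ((n%:R - 2) / 2))].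
Proof.
move=> n2 [phi [tphi _ phi_cvg]] uU U0 Un.
have nR : 2 < n%:R :> R by rewrite (ltr_nat _ 2).
have n0 : (0 < n)%N by exact: ltn_trans n2.
pose q := crit_exp R n.
have q0 : 0 < q by rewrite /q /crit_exp divr_gt0 ?mulr_gt0 //; lra.
have [j hj] : exists j, ('N[lebesgue_rV R n]_q%:E[EFin \o (phi j \- u)%R] <= 1%:E)%E.
  have : \forall j \near \oo, ('N[lebesgue_rV R n]_q%:E[EFin \o (phi j \- u)%R] < 1%:E)%E.
    apply: (phi_cvg [set y | (y < 1%:E)%E]).
    by apply: open_ereal_lt'; rewrite lte_fin.
  by move=> [j _ H]; exists j; apply/ltW; apply: H => /=.
have [M [M0 HM]] : exists M : R, 0 < M /\ forall x i, M <= x ord0 i -> phi j x = 0.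
  have [_ /compact_bounded [M [_ HM]]] := tphi j.
  exists (`|M| + 2); split; first by rewrite ltr_wpDl.
  move=> x i Mx; apply/eqP/negPn/negP => px.
  have : `|x| <= `|M| + 1.
    apply: (HM (`|M| + 1)); first by have := ler_norm M; lra.
    by apply: subset_closure.
  move=> xM; have : `|x ord0 i| <= `|x|.
    rewrite [leRHS]mx_normrE.
    exact: (le_bigmax _ (fun ij : 'I_1 * 'I_n => `|x ij.1 ij.2|) (ord0, i)).
  by have := ler_norm (x ord0 i); lra.
pose a := (n%:R - 2) / 2 : R.
have aq : a * q = n%:R by rewrite /a /q /crit_exp; field; lra.
pose r0 := 2 * n%:R * (M + 1).
have r00 : 1 <= r0.
  rewrite /r0; have : 1 * 1 <= n%:R * (M + 1) by rewrite ler_pM //; lra.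
  by lra.
exists ((2 * n%:R) `^ a), r0; split => //; first by rewrite powR_gt0 // mulr_gt0 //; lra.
move=> r rr; have r_gt0 : 0 < r by lra.
(* Every point of [rho, 2 rho]^n has norm at most 2 rho sqrt n <= 2 n rho = r, so u >= U(r) on this
   cube. *)
pose rho := r / (2 * n%:R).
have n2R : 0 < 2 * n%:R :> R by rewrite mulr_gt0 //; lra.
have rho0 : 0 < rho by rewrite divr_gt0.
have rhoM : M <= rho by rewrite /rho ler_pdivlMr // mulrC; move: rr; rewrite /r0; lra.
have rE : r = 2 * n%:R * rho by rewrite /rho mulrC divfK // gt_eqF.
have fm x : (forall i, rho <= x ord0 i <= 2 * rho) -> U r <= `|(phi j \- u)%R x|.
  move=> xB; have /andP[x1 _] := xB (Ordinal n0).
  rewrite /= (HM _ (Ordinal n0)) ?(le_trans rhoM) // sub0r normrN uU.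
  have xrho : rho <= enorm x.
    by apply: le_trans x1 (le_trans (ler_norm _) (coord_le_enorm x _)).
  rewrite ger0_norm; last by apply/ltW/U0; exact: lt_le_trans xrho.
  apply: Un; first exact: lt_le_trans xrho.
  rewrite -(@ler_sqr R) ?nnegrE ?enorm_ge0 ?(ltW r_gt0) // enorm2.
  apply: (@le_trans _ _ (\sum_(i < n) (2 * rho) ^+ 2)).
    apply: ler_sum => i _; have /andP[y1 y2] := xB i.
    by rewrite ler_sqr ?nnegrE //; lra.
  rewrite sumr_const card_ord -[leLHS]mulr_natl rE.
  rewrite (_ : (2 * n%:R * rho) ^+ 2 = n%:R * (n%:R * (2 * rho) ^+ 2)); last by ring.
  by rewrite ler_wpM2l // ler_peMl ?sqr_ge0 //; lra.
have := Lnorm_box q0 rho0 (ltW (U0 _ r_gt0)) ler01 fm hj.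
rewrite powR1 => H.
have H2 : U r `^ q <= rho `^ (- n%:R).
  by rewrite powRN powR_mulrn ?(ltW rho0) // -[leRHS]div1r ler_pdivlMr ?exprn_gt0.
have -> : U r = (U r `^ q) `^ q^-1.
  by rewrite -powRrM mulfV ?gt_eqF // powRr1 // ltW // U0.
have -> : (2 * n%:R) `^ a * r `^ (- ((n%:R - 2) / 2)) = (rho `^ (- n%:R)) `^ q^-1.
  have nq : n%:R * q^-1 = a by rewrite -aq mulfK ?gt_eqF.
  have n2V : 0 <= (2 * n%:R)^-1 :> R by rewrite invr_ge0 ltW.
  rewrite -powRrM mulNr nq -/a /rho (powRM (- a) (ltW r_gt0) n2V).
  rewrite [LHS]mulrC; congr (_ * _).
  by rewrite -powR_inv1 ?(ltW n2R) // -powRrM mulrNN mul1r.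
by apply: powR_le => //; [rewrite invr_ge0 ltW|exact: powR_ge0].
Qed.

End RadialTestFunctions.

(** * Approximating the profile as a function of r^2 *)

Section ProfileApproximation.
Context {R : realType}.
Implicit Types (f : R -> R) (r s : R).

Lemma continuous_quotient (v v' : R -> R) : v 0 = 0 ->
  (forall r, is_derive r 1 v (v' r)) ->
  continuous (fun r => if r == 0 then v' 0 else v r / r).
Proof.
move=> v0 Dv r; have [->|r0] := eqVneq r 0; last first.
  have C : {for r, continuous (fun r => v r / r)}.
    by apply: (@der_continuous _ _ (fun r => v' r / r + v r * (- 1 / r ^+ 2)));
      exact: (derM (Dv r) (derV r0 (derid r))).
  have E : \forall y \near r, (if y == 0 then v' 0 else v y / y) = v y / y.
    have o : open (~` [set 0 : R]).
      exact/closed_openC/accessible_closed_set1/hausdorff_accessible/norm_hausdorff.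
    have : nbhs r (~` [set 0 : R]) by apply: open_nbhs_nbhs; split => //; apply/eqP.
    by apply: filterS => y /eqP /negbTE ->.
  rewrite /continuous_at (negbTE r0); apply: cvg_trans C.
  by apply: near_eq_cvg; apply: filterS E => y ->.
have [D V] := Dv 0.
have L : (fun h : R => h^-1 *: ((v \o shift 0) (h *: (1 : R)) - v 0)) @ 0^' --> v' 0.
  by rewrite -V; exact: D.
rewrite /continuous_at eqxx; apply/cvgrPdist_le => e e0.
have /cvgrPdist_le /(_ e e0) H := L.
have H' : nbhs (0 : R) (fun h => h != 0 ->
    `|v' 0 - h^-1 *: ((v \o shift 0) (h *: (1 : R)) - v 0)| <= e) by exact: H.
apply: filterS H' => h; have [->|h0] := eqVneq h 0; first by move=> _; rewrite subrr normr0 ltW.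
by move=> /(_ isT) /=; rewrite addr0 v0 subr0 [h *: 1]mulr1 [h^-1 *: _]mulrC.
Qed.

Lemma le0_at0 f : {for 0, continuous f} -> (forall s, 0 < s -> f s <= 0) -> f 0 <= 0.
Proof.
move=> cf fs; rewrite leNgt; apply/negP => f0.
have /cvgrPdist_lt /(_ _ f0) [d /= d0 H] := cf.
have d2 : 0 < d / 2 by rewrite divr_gt0.
have : `|f 0 - f (d / 2)| < f 0.
  apply: H; rewrite /= sub0r normrN gtr0_norm //.
  by rewrite ltr_pdivrMr // ltr_pMr // (ltr_nat _ 1 2).
by have := ler_norm (f 0 - f (d / 2)); have := fs _ d2; lra.
Qed.

Variables (n : R) (U v v' : R -> R).
Hypothesis n_gt2 : 2 < n.
Hypothesis U_der : forall r, is_derive r 1 U (- v r).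
Hypothesis v_der : forall r, is_derive r 1 v (v' r).
Hypothesis v0 : v 0 = 0.
Hypothesis U_gt0 : forall r, 0 < r -> 0 < U r.
Hypothesis U_cvg0 : forall e : R, 0 < e -> exists M : R, forall r, M < r -> U r < e.

Let q r : R := if r == 0 then v' 0 else v r / r.
(** [Num.sqrt] is 0 on negative arguments, so [f] and [f'] are constant there and continuous on the
    whole line, although [f'] serves as the derivative of [f] only for s > 0. *)
Let f s : R := U (Num.sqrt s).
Let f' s : R := - 2^-1 * q (Num.sqrt s).

Let f'_continuous : continuous f'.
Proof.
move=> s; have C : {for s, continuous (fun s => q (Num.sqrt s))}.
  apply: (@continuous_comp R R R (@Num.sqrt R) q); first exact: sqrt_continuous.
  exact: continuous_quotient.
exact: (continuousM (@cst_continuous _ _ (- 2^-1 : R) s) C).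
Qed.

Let f_continuous : continuous f.
Proof.
move=> s; apply: (@continuous_comp R R R (@Num.sqrt R) U); first exact: sqrt_continuous.
exact: (@der_continuous _ U (fun r => - v r)).
Qed.

Let f_der s : 0 < s -> is_derive s 1 f (f' s).
Proof.
move=> s0; have r0 : 0 < Num.sqrt s by rewrite sqrtr_gt0.
apply: (is_derive_eq (der_comp (U_der _) (is_derive1_sqrt s0))).
by rewrite /f' /q gt_eqF //; field; rewrite gt_eqF.
Qed.

(* Cutting f' off beyond T and smoothing the result gives a g' that is close to
   f' in the weighted norm; the bound on g - f follows by integrating from
   infinity, where both vanish. *)
Lemma profile_approx (C r0 : R) : 0 < C -> 1 <= r0 ->
  (forall r, r0 <= r -> `|v r| <= C * r `^ (1 - n)) ->
  forall e : R, 0 < e -> exists g : R -> R, exists g' : R -> R, exists T : R,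
    [/\ forall k, smooth_upto k g, forall s, is_derive s 1 g (g' s),
      forall s, T <= s -> g s = 0 & forall s, 0 <= s ->
      `|g' s - f' s| <= e * (1 + s) `^ (- ((3 * n + 2) / 8)) /\
      `|g s - f s| <= e * (1 + s) `^ (1 - (3 * n + 2) / 8)].
Proof.
move=> C0 r01 vC e e0; have n2 := n_gt2.
(* The midpoint of (n+2)/4 and n/2: membership in D^{1,2} requires K above the first, and [f'] =
   O(s^(-n/2)) beats the weight only for K below the second. *)
set K := (3 * n + 2) / 8.
have K1 : 0 < K - 1 by rewrite /K; lra.
(* The second entry pays for the factor 1/(K-1) that appears on integrating the weight
   (1+s)^(-K). *)
pose e1 := Num.min e (e * (K - 1)).
have e10 : 0 < e1 by rewrite lt_min e0 mulr_gt0.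
have e1e : e1 <= e by rewrite ge_min lexx.
have e1K : e1 / (K - 1) <= e by rewrite ler_pdivrMr // ge_min lexx orbT.
pose wt s := (1 + s) `^ (- K).
have wt0 s : 0 <= wt s by exact: powR_ge0.
pose dl := n / 2 - K.
have dl0 : 0 < dl by rewrite /dl /K; lra.
pose C3 := C * 2 `^ (n / 2).
have C30 : 0 < C3 by rewrite mulr_gt0 // powR_gt0.
have e2 : 0 < e1 / 2 by rewrite divr_gt0.
(* Beyond r0^2 the bound on v applies; beyond the second value the surplus decay s^(-dl) reduces C3
   to e1 / 2. *)
pose T := Num.max (r0 ^+ 2) ((C3 / (e1 / 2)) `^ dl^-1).
have T1 : 1 <= T by rewrite le_max expr_ge1 //; lra.
have tail s : T <= s -> `|f' s| <= e1 / 2 * wt s.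
  rewrite ge_max => /andP[rs es].
  have s1 : 1 <= s by apply: le_trans rs; rewrite expr_ge1 //; lra.
  have s0 : 0 < s by lra.
  have sq0 : 0 < Num.sqrt s by rewrite sqrtr_gt0.
  have rsq : r0 <= Num.sqrt s.
    rewrite -(@ler_sqr R) ?nnegrE ?sqr_sqrtr ?(ltW s0) ?(ltW sq0) //; lra.
  have sq1 : 1 <= Num.sqrt s by lra.
  have F1 : `|f' s| <= C * Num.sqrt s `^ (- n).
    have V1 : `|v (Num.sqrt s)| / Num.sqrt s <= C * Num.sqrt s `^ (- n).
      rewrite ler_pdivrMr // -mulrA -powR_add1 // (_ : - n + 1 = 1 - n); last ring.
      exact: vC.
    rewrite /f' /q gt_eqF // normrM normrN normfV (ger0_norm (ler0n _ 2)).
    rewrite normrM normfV (gtr0_norm sq0).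
    have : 0 <= `|v (Num.sqrt s)| / Num.sqrt s by rewrite divr_ge0 // ltW.
    by move: V1; move: (_ / Num.sqrt s) => X; lra.
  apply: le_trans F1 _.
  have F2 : Num.sqrt s `^ (- n) <= 2 `^ (n / 2) * (1 + s) `^ (- (n / 2)).
    rewrite -powR12_sqrt ?(ltW s0) // -powRrM.
    rewrite (_ : 2^-1 * - n = - (n / 2)); last by field.
    have -> : 2 `^ (n / 2) * (1 + s) `^ (- (n / 2)) = ((1 + s) / 2) `^ (- (n / 2)).
      rewrite powRM ?invr_ge0 //; last lra.
      by rewrite -(@powR_inv1 _ 2) // -powRrM mulrNN mul1r mulrC.
    by apply: powR_opp_le; lra.
  apply: (@le_trans _ _ (C3 * (1 + s) `^ (- (n / 2)))).
    by rewrite /C3 -mulrA ler_wpM2l // ltW.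
  have -> : - (n / 2) = - dl + - K by rewrite /dl; ring.
  rewrite powR_addp; last lra.
  rewrite mulrA ler_wpM2r ?powR_ge0 //.
  have -> : e1 / 2 = C3 * ((C3 / (e1 / 2)) `^ dl^-1) `^ (- dl).
    rewrite -powRrM mulrN mulVf ?gt_eqF // powR_inv1; last by rewrite divr_ge0 // ltW.
    by field; rewrite !gt_eqF.
  rewrite ler_wpM2l ?(ltW C30) //; apply: powR_opp_le; first exact: ltW.
    by rewrite powR_gt0 // divr_gt0.
  by lra.
(* A piecewise linear cutoff, 1 up to T and 0 from T + 1 on; absolute values make its continuity
   immediate. *)
pose chi s : R := (`|T + 1 - s| - `|T - s| + 1) / 2.
have chi1 s : s <= T -> chi s = 1.
  by move=> sT; rewrite /chi !ger0_norm; lra.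
have chi0 s : T + 1 <= s -> chi s = 0.
  by move=> sT; rewrite /chi !ler0_norm; lra.
have chi01 s : 0 <= chi s <= 1.
  have := ler_dist_dist (T + 1 - s) (T - s).
  rewrite (_ : T + 1 - s - (T - s) = 1) ?normr1; last ring.
  by rewrite ler_norml /chi; lra.
have chi_cont : continuous chi.
  have cn (c : R) : continuous (fun s : R => `|c - s|).
    move=> s; apply: cvg_norm; apply: cvgB; first exact: cvg_cst.
    exact: cvg_id.
  move=> s; exact: (continuousM (continuousD (continuousB (cn (T + 1) s) (cn T s))
    (@cst_continuous _ _ (1 : R) s)) (@cst_continuous _ _ (2^-1 : R) s)).
pose k s := f' s * chi s.
have k_cont : continuous k.
  move=> s; have Cf : {for s, continuous f'} by exact: f'_continuous.
  have Cc : {for s, continuous chi} by exact: chi_cont.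
  exact: (continuousM Cf Cc).
have k0 s : T + 1 <= s -> k s = 0 by move=> sT; rewrite /k chi0 // mulr0.
(* (2 + T)^(-K) is the least value of the weight on [0, T + 1], so a uniform error eta there is a
   weighted error e1 / 2. *)
pose eta := e1 / 2 * (2 + T) `^ (- K).
have eta0 : 0 < eta by rewrite mulr_gt0 // powR_gt0; lra.
have T10 : 0 < T + 1 by lra.
have [g [g' [smg Dg gk gT]]] := smooth_primitive_approx k_cont T10 k0 eta0.
have kf s : 0 <= s -> `|k s - f' s| <= e1 / 2 * wt s.
  move=> s0; have [sT|Ts] := leP s T.
    by rewrite /k chi1 // mulr1 subrr normr0 mulr_ge0 // ltW.
  rewrite (_ : k s - f' s = f' s * (chi s - 1)); last by rewrite /k; ring.
  rewrite normrM; apply: le_trans (tail _ (ltW Ts)); rewrite ler_piMr //.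
  by have := chi01 s; rewrite ler_norml; lra.
have gf s : 0 <= s -> `|g' s - f' s| <= e1 * wt s.
  move=> s0; rewrite (_ : e1 * wt s = e1 / 2 * wt s + e1 / 2 * wt s); last by field.
  have [sT|Ts] := leP s (T + 1); last first.
    have [_ ->] := gT _ (ltW Ts); rewrite sub0r normrN.
    have Ts' : T <= s by lra.
    by apply: le_trans (tail _ Ts') _; rewrite lerDl mulr_ge0 // ltW.
  rewrite (_ : g' s - f' s = (g' s - k s) + (k s - f' s)); last ring.
  apply: le_trans (ler_normD _ _) _; apply: lerD; last exact: kf.
  apply: le_trans (gk s s0) _; rewrite ler_wpM2l ?(ltW e2) // powR_opp_le //.
  - by rewrite /K; lra.
  - by lra.
  - by lra.
(* The derivative of [B] is - e1 times the weight, so g - f - B and f - g - B are nondecreasing on s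
   > 0 and are controlled by their behaviour at infinity. *)
pose B s := e1 / (K - 1) * (1 + s) `^ (1 - K).
have B_gt0 s : 0 <= s -> 0 < B s.
  by move=> s0; rewrite mulr_gt0 ?divr_gt0 ?powR_gt0 //; lra.
have B_der s : 0 <= s -> is_derive s 1 B (- (e1 * wt s)).
  move=> s0; have p0 : 0 < 1 + s by lra.
  apply: (is_derive_eq (derZ (e1 / (K - 1)) (derpow (f := fun x => 1 + x) (1 - K) p0
    (derD (dercst 1 s) (derid s))))).
  by rewrite (_ : 1 - K - 1 = - K) /wt; [field; lra|ring].
have B_cont : {for 0, continuous B}.
  by apply: (@der_continuous _ B (fun s => - (e1 * wt s))); exact: B_der.
have g_cont : {for 0, continuous g} by exact: (@der_continuous _ g g').
have f_gt0 s : 0 < s -> 0 < f s by move=> s0; rewrite U_gt0 // sqrtr_gt0.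
have up s : 0 < s -> g s - f s - B s <= 0.
  move=> s0; pose t := Num.max s (T + 1).
  have st : s <= t by rewrite le_max lexx.
  have tT : T + 1 <= t by rewrite le_max lexx orbT.
  have t0 : 0 < t by lra.
  have : g s - f s - B s <= g t - f t - B t.
    apply: (@der_ge0_le _ (fun s => g s - f s - B s) (fun s => g' s - f' s - - (e1 * wt s))) => //.
      move=> z /andP[sz _]; have z0 : 0 < z by lra.
      exact: (derB (derB (Dg z) (f_der z0)) (B_der _ (ltW z0))).
    move=> z /andP[sz _]; have z0 : 0 <= z by lra.
    by have := gf _ z0; rewrite ler_norml; lra.
  have [-> _] := gT _ tT; have := f_gt0 _ t0; have := B_gt0 _ (ltW t0); lra.
(* Unlike in the opposite bound, the sign of f is unfavourable here: f only tends to 0, so a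
   positive value is contradicted far out. *)
have lo s : 0 < s -> f s - g s - B s <= 0.
  move=> s0; rewrite leNgt; apply/negP => X0.
  have [M HM] := U_cvg0 X0.
  pose t := Num.max (Num.max s (T + 1)) ((`|M| + 1) ^+ 2).
  have st : s <= t by rewrite !le_max lexx.
  have tT : T + 1 <= t by rewrite !le_max lexx orbT.
  have t0 : 0 < t by lra.
  have tM : M < Num.sqrt t.
    apply: lt_le_trans (_ : `|M| + 1 <= _); first by have := ler_norm M; lra.
    rewrite -(@ler_sqr R) ?nnegrE ?sqrtr_ge0 ?addr_ge0 // sqr_sqrtr ?(ltW t0) //.
    by rewrite le_max lexx orbT.
  have : f s - g s - B s <= f t - g t - B t.
    apply: (@der_ge0_le _ (fun s => f s - g s - B s) (fun s => f' s - g' s - - (e1 * wt s))) => //.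
      move=> z /andP[sz _]; have z0 : 0 < z by lra.
      exact: (derB (derB (f_der z0) (Dg z)) (B_der _ (ltW z0))).
    move=> z /andP[sz _]; have z0 : 0 <= z by lra.
    by have := gf _ z0; rewrite ler_norml; lra.
  have [-> _] := gT _ tT; have := HM _ tM; rewrite -/(f t); have := B_gt0 _ (ltW t0); lra.
have cf0 : {for 0, continuous f} by exact: f_continuous.
exists g, g', (T + 1); split => //; first by move=> s /gT[].
move=> s s0; split.
  by apply: le_trans (gf s s0) _; rewrite ler_wpM2r.
apply: (@le_trans _ _ (B s)); last by rewrite /B ler_wpM2r // powR_ge0.
(* The derivative of [f] is at hand only for s > 0; the value s = 0 is reached by continuity. *)
have [up' lo'] : g s - f s - B s <= 0 /\ f s - g s - B s <= 0.
  move: s0; rewrite le_eqVlt => /predU1P[<-|s0]; last by split; [exact: up|exact: lo].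
  split.
    apply: (@le0_at0 (fun s => g s - f s - B s)) => //.
    exact: (continuousB (continuousB g_cont cf0) B_cont).
  apply: (@le0_at0 (fun s => f s - g s - B s)) => //.
  exact: (continuousB (continuousB cf0 g_cont) B_cont).
by rewrite ler_norml; lra.
Qed.

End ProfileApproximation.

(** * The two cases *)

Section Dichotomy.
Context {R : realType} {n' : nat}.
Let N := n'.+3.
Variables (p : R) (u : 'rV[R]_N -> R).
Hypothesis hp : crit_exp R N - 1 < p.
Hypothesis u_C2 : Ck 2 u.
Hypothesis u_radial : radial u.
Hypothesis u_spacelike : forall x, enorm (grad u x) < 1.
Hypothesis u_eq : forall x, mean_curvature u x + u x `^ p = 0.
Hypothesis u_pos : forall x, 0 < u x.
Hypothesis u_lim : u x @[x --> at_infty] --> (0 : R).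

Implicit Types (r e s t : R).

Let U := profile u.
Let w := flux u.
Let nR : R := N%:R.

Let n_gt2 : 2 < nR. Proof. by rewrite /nR (ltr_nat _ 2). Qed.

Let p_super : nR + 2 < p * (nR - 2).
Proof.
have n2 := n_gt2; have := hp; rewrite /crit_exp -/nR.
rewrite (_ : 2 * nR / (nR - 2) - 1 = (nR + 2) / (nR - 2)); last by field; lra.
by rewrite ltr_pdivrMr; lra.
Qed.

Let e0 : 'rV[R]_N := delta_mx ord0 ord0.

Let enorm_ray r : 0 <= r -> enorm (r *: e0) = r.
Proof. by move=> r0; rewrite enormZ enorm_delta mulr1 ger0_norm. Qed.

Let U_gt0 r : 0 < r -> 0 < U r. Proof. by move=> _; exact: u_pos. Qed.

Let U_der r : 0 < r -> is_derive r 1 U (- (w r / Num.sqrt (1 + w r ^+ 2))).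
Proof. by move=> _; rewrite -slope_fluxE //; exact: profile_der. Qed.

Let w_der r : 0 < r -> is_derive r 1 w (U r `^ p - (nR - 1) / r * w r).
Proof. by move=> r0; exact: flux_der. Qed.

Let w_bound0 : exists C d : R, 0 < d /\ forall r : R, 0 < r < d -> `|w r| <= C.
Proof. exact: flux_bounded_near0. Qed.

Let U_cvg0 e : 0 < e -> exists M : R, forall r : R, M < r -> U r < e.
Proof.
move=> ee; have /cvgr0Pnorm_lt /(_ e ee) [M _ HM] := u_lim.
exists (Num.max M 0) => r; rewrite gt_max => /andP[Mr r0].
have := HM (r *: e0); rewrite /= enorm_ray ?(ltW r0) // => /(_ Mr).
by apply: le_lt_trans; exact: ler_norm.
Qed.

Let fast := exists a C r0 : R, [/\ 2 / (p - 1) < a, 0 < C, 1 <= r0 &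
  forall r : R, r0 <= r -> U r <= C * r `^ (- a)].

Let fastP : fast -> exists C r0 : R, [/\ 0 < C, 1 <= r0 &
  forall r : R, r0 <= r -> w r <= C * r `^ (1 - nR) /\ U r <= C * r `^ (2 - nR)].
Proof.
move=> [a [C [r0 [aa C0 r01 UC]]]].
have [C' [C'0 H]] := fast_decay n_gt2 p_super U_gt0 U_der w_der U_cvg0 w_bound0 aa C0 r01 UC.
by exists C', r0.
Qed.

Let fast_D12 : fast -> D12 u.
Proof.
move=> /fastP [C [r0 [C0 r01 wU]]].
have v_bound r : r0 <= r -> `|slope u r| <= C * r `^ (1 - nR).
  move=> rr; have r_gt0 : 0 < r by lra.
  have w0 := flux_gt0 n_gt2 p_super U_gt0 w_der w_bound0 r_gt0.
  have [wC _] := wU _ rr; rewrite slope_fluxE //.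
  have s1 : 1 <= Num.sqrt (1 + flux u r ^+ 2).
    by rewrite -[leLHS]sqrtr1 ler_wsqrtr // lerDl sqr_ge0.
  rewrite ger0_norm; last by rewrite divr_ge0 ?sqrtr_ge0 // ltW.
  rewrite ler_pdivrMr; last lra.
  by apply: le_trans wC _; rewrite ler_peMr // mulr_ge0 ?powR_ge0 ?(ltW C0).
have A := profile_approx n_gt2 (profile_der u_C2) (slope_der u_C2) (slope0 u_C2 u_radial)
  U_gt0 U_cvg0 C0 r01 v_bound.
apply: (D12_radial _ _ _ A) => //.
- by have := n_gt2; rewrite /nR; lra.
- by move=> x; rewrite sqrtr_sqr ger0_norm ?enorm_ge0 // -profileE.
Qed.

Let fast_O : fast -> u =O_at_infty (fun x => 1 / enorm x ^+ (N - 2)).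
Proof.
move=> /fastP [C [r0 [C0 r01 wU]]].
apply/eqO_exP; exists C => //; exists r0 => // x /= xr.
have x0 : 0 < enorm x by lra.
have [_ UC] := wU _ (ltW xr).
rewrite gtr0_norm // ger0_norm; last by rewrite divr_ge0 // exprn_ge0 // ltW.
rewrite profileE //; apply: le_trans UC _.
rewrite (_ : 2 - nR = - (N - 2)%:R); last by rewrite natrB // opprB.
by rewrite powRN powR_mulrn ?(ltW x0) // mul1r.
Qed.

Let D12_fast : D12 u -> fast.
Proof.
move=> Du.
have Un s t := @U_nincr R nR p U w n_gt2 p_super U_gt0 U_der w_der w_bound0 s t.
have [C [r0 [C0 r01 UC]]] := @D12_radial_decay _ N u U isT Du (profileE u_radial) U_gt0 Un.
exists ((nR - 2) / 2), C, r0; split => //.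
have n2 := n_gt2; have ps := p_super.
have p1 : 0 < p - 1 by rewrite -(@pmulr_lgt0 _ (nR - 2)) ?subr_gt0 //; lra.
by rewrite ltr_pdivrMr //; lra.
Qed.

Let near_fast : (exists alpha : R, 2 / (p - 1) < alpha /\
  exists c : R, 0 < c /\ \forall x \near at_infty, u x <= c / enorm x `^ alpha) -> fast.
Proof.
move=> [a [aa [c [c0 [M _ HM]]]]].
exists a, c, (`|M| + 1); split => //; first by rewrite lerDr.
move=> r rM; have r0 : 0 < r by apply: lt_le_trans rM; rewrite ltr_wpDl.
have := HM (r *: e0); rewrite /= enorm_ray ?(ltW r0) // powRN; apply.
by have := ler_norm M; lra.
Qed.

Lemma radial_solution_dichotomy :
  (D12 u /\ u =O_at_infty (fun x => 1 / enorm x ^+ (N - 2)))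
  \/
  [/\ ~ D12 u,
      exists c1 c2 : R, [/\ 0 < c1, 0 < c2 &
        \forall x \near at_infty,
          c1 / enorm x `^ (2 * N%:R / ((N%:R - 1) * (p + 1) - 2 * N%:R)) <= u x
          <= c2 / enorm x `^ (2 / (p - 1))] &
      ~ (exists alpha : R, 2 / (p - 1) < alpha /\
          exists c : R, 0 < c /\
            \forall x \near at_infty, u x <= c / enorm x `^ alpha)].
Proof.
have [F|nF] := pselect fast; first by left; split; [exact: fast_D12|exact: fast_O].
right; split; [by move=> /D12_fast| |by move=> /near_fast].
have [//|[c1 [r1 [c10 r11 lo]]]] := decay_dichotomy n_gt2 p_super U_gt0 U_der w_der w_bound0.
have [c2 [r2 [c20 r21 up]]] := decay_upper n_gt2 p_super U_gt0 U_der w_der w_bound0.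
exists c1, c2; split => //; exists (Num.max r1 r2) => // x /=.
rewrite gt_max => /andP[/ltW x1 /ltW x2].
rewrite (profileE u_radial) -/U -!powRN; apply/andP; split; [exact: lo|exact: up].
Qed.

End Dichotomy.

Theorem theorem0p3 (R : realType) (N : nat) (p : R) (u : 'rV[R]_N -> R)
    (hN : (3 <= N)%N)
    (hp : crit_exp R N - 1 < p)
    (u_C2 : Ck 2 u)
    (u_radial : radial u)
    (u_spacelike : forall x, enorm (grad u x) < 1)
    (u_eq : forall x, mean_curvature u x + u x `^ p = 0)
    (u_pos : forall x, 0 < u x)
    (u_lim : u x @[x --> at_infty] --> (0 : R)) :
  (D12 u /\ u =O_at_infty (fun x => 1 / enorm x ^+ (N - 2)))
  \/
  [/\ ~ D12 u,
      exists c1 c2 : R, [/\ 0 < c1, 0 < c2 &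
        \forall x \near at_infty,
          c1 / enorm x `^ (2 * N%:R / ((N%:R - 1) * (p + 1) - 2 * N%:R)) <= u x
          <= c2 / enorm x `^ (2 / (p - 1))] &
      ~ (exists alpha : R, 2 / (p - 1) < alpha /\
          exists c : R, 0 < c /\
            \forall x \near at_infty, u x <= c / enorm x `^ alpha)].
Proof.
case: N u hN hp u_C2 u_radial u_spacelike u_eq u_pos u_lim => [//|[//|[//|n']]] u _.
exact: radial_solution_dichotomy.
Qed.
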